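(* Each of the following 29 knot classes $[K]$ (in Rolfsen notation), $$3_1,\ 4_1,\ 5_1,\ 5_2,\ 6_1,\ 6_2,\ 6_3,\ 7_1,\ 7_2,\ 7_3,\ 7_4,\ 7_5,\ 7_6,\ 7_7,\ 8_{16},\ 8_{17},\ 8_{18},\ 8_{19},\ 8_{20},\ 8_{21},$$ $$9_{29},\ 9_{34},\ 9_{40},\ 9_{41},\ 9_{42},\ 9_{44},\ 9_{46},\ 9_{47},\ 9_{49},$$ satisfies $$rs[K]=s[K]-2,$$ where $s[K]$ is the stick number and $rs[K]$ the rail stick number of $[K]$.
   Context: Everything is in the piecewise linear category. A stick knot is a p.l. knot in $\mathbb{R}^3$ seen as a finite union of line segments called sticks; the stick number $s[K]$ of a p.l. knot class $[K]$ is the minimum number of sticks of a stick knot representing $[K]$. The known stick numbers of these classes recorded from the literature are: $6$ for $3_1$; $7$ for $4_1$; $8$ for $5_1,5_2,6_1,6_2,6_3,8_{19},8_{20}$; and $9$ for all the remaining classes in the list. Let $\ell_1,\ell_2\subset\mathbb{R}^3$ be two parallel lines, called rails. A stick rail arc is an embedded arc that is a finite union of line segments (sticks), with one endpoint on $\ell_1$, the other on $\ell_2$, and interior disjoint from $\ell_1\cup\ell_2$. Companions. Generically projecting a rail arc onto a plane perpendicular to the rails gives a planar knotoid diagram $\kappa$ (a generic immersion of $[0,1]$ in the plane with crossing information and with distinct endpoints). Join the endpoints of $\kappa$ by a generic immersed arc $\alpha$ transverse to $\kappa$. Taking $\alpha$ to pass under $\kappa$ at every intersection gives a knot diagram whose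 knot class is the under companion; taking $\alpha$ to pass over $\kappa$ at every intersection gives the over companion. These classes do not depend on $\alpha$. The rail stick number $rs[K]$ of a knot class $[K]$ is the minimum number of sticks needed to create a stick rail arc whose under or over companion is $[K]$. *)

(* Defs.v *)
From HB Require Import structures.
From mathcomp Require Import all_boot all_order all_algebra.
From mathcomp Require Import boolp classical_sets reals.
Set Implicit Arguments.
Unset Strict Implicit.
Unset Printing Implicit Defensive.
Import Order.TTheory GRing.Theory Num.Theory.
Local Open Scope classical_set_scope.
Local Open Scope ring_scope.

(* Minimum of a set of naturals, with junk value 0 on the empty set.  Knots have
   at least three sticks, so an equality with a stick number minus two never
   holds by virtue of the junk value. *)
Definition nat_min (A : set nat) : nat :=
  xget 0%N [set n | A n /\ forall m, A m -> (n <= m)%N].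

(** Polygons.  A sequence of vertices stands for the polygonal line through
    them or, read cyclically, for the closed polygon; in the latter reading the
    last edge goes back to the first vertex, whence the modulus. *)

Section Polygons.
Context {R : realType}.
Implicit Types (s : seq 'rV[R]_3) (a b c p v w d : 'rV[R]_3) (x y z : nat * R).

Definition segment a b : set 'rV[R]_3 :=
  [set p | exists t, [/\ 0 <= t, t <= 1 & p = (1 - t) *: a + t *: b]].

Definition triangle a b c : set 'rV[R]_3 :=
  [set p | exists t u v : R, [/\ [/\ 0 <= t, 0 <= u & 0 <= v],
     t + u + v = 1 & p = t *: a + u *: b + v *: c]].

Definition edge_dir s (i : nat) : 'rV[R]_3 :=
  nth 0 s (i.+1 %% size s)%N - nth 0 s i.

(* The parameter x = (i, t) denotes the point at time t of the i-th edge. *)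
Definition poly_pt s x : 'rV[R]_3 := nth 0 s x.1 + x.2 *: edge_dir s x.1.

Definition closed_param s x : Prop := (x.1 < size s)%N /\ 0 <= x.2 < 1.

Definition trace s : set 'rV[R]_3 :=
  [set p | exists2 x, closed_param s x & p = poly_pt s x].

(* Its sticks are its edges, so a stick knot s has size s sticks. *)
Definition stick_knot s : Prop :=
  (0 < size s)%N /\
  forall x y, closed_param s x -> closed_param s y ->
    poly_pt s x = poly_pt s y -> x = y.

(* P.l. knot classes in the sense of Reidemeister: unoriented polygons up to
   triangle moves.  The move replaces the edge from the last vertex to the
   first one by the two other sides of a triangle which meets the knot only
   along that edge.  Mirror images are not identified. *)
Inductive knot_equiv : seq 'rV[R]_3 -> seq 'rV[R]_3 -> Prop :=
| KnotRefl s : knot_equiv s s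
| KnotSym s s' : knot_equiv s s' -> knot_equiv s' s
| KnotTrans s s' s'' : knot_equiv s s' -> knot_equiv s' s'' -> knot_equiv s s''
| KnotRot n s : knot_equiv s (rot n s)
| KnotRev s : knot_equiv s (rev s)
| KnotTriangle w s :
    stick_knot s -> stick_knot (w :: s) ->
    trace s `&` triangle (last w s) w (head w s)
      `<=` segment (last w s) (head w s) ->
    knot_equiv s (w :: s).

Definition stick_number (K : seq 'rV[R]_3) : nat :=
  nat_min [set n | exists s,
    [/\ stick_knot s, knot_equiv s K & size s = n]].

(** Orthogonal projection along a direction d *)

Definition dotv p d : R := (p *m d^T) 0 0.

Definition proj d p : 'rV[R]_3 := p - (dotv p d / dotv d d) *: d.

(* A generic closed curve in the plane: its multiple points are transverse
   double points, none of them at (the projection of) a vertex.  In particular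
   edges do not project to points and consecutive edges do not fold back. *)
Definition regular_projection d s : Prop :=
  [/\ (0 < size s)%N,
      forall x y, closed_param s x -> closed_param s y -> x <> y ->
        proj d (poly_pt s x) = proj d (poly_pt s y) ->
        [/\ 0 < x.2, 0 < y.2 &
            row_free (col_mx (proj d (edge_dir s x.1))
                             (proj d (edge_dir s y.1)))] &
      forall x y z, closed_param s x -> closed_param s y -> closed_param s z ->
        proj d (poly_pt s x) = proj d (poly_pt s y) ->
        proj d (poly_pt s y) = proj d (poly_pt s z) ->
        [\/ x = y, y = z | x = z]].

Definition line b d : set 'rV[R]_3 := [set p | exists t, p = b + t *: d].

End Polygons.

(** Rails and rail arcs *)

Record rails (R : realType) := Rails {
  rail_dir : 'rV[R]_3;
  rail_base1 : 'rV[R]_3;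
  rail_base2 : 'rV[R]_3;
  rail_dir_neq0 : rail_dir != 0;
  rails_distinct : forall t : R, rail_base2 - rail_base1 != t *: rail_dir }.

Section Rails.
Context {R : realType} (L : rails R).
Implicit Types (A B K : seq 'rV[R]_3) (x y : nat * R).

Definition rail1 : set 'rV[R]_3 := line (rail_base1 L) (rail_dir L).
Definition rail2 : set 'rV[R]_3 := line (rail_base2 L) (rail_dir L).

Definition height (p : 'rV[R]_3) : R := dotv p (rail_dir L).

Definition arc_param A x : Prop := (x.1.+1 < size A)%N /\ 0 <= x.2 <= 1.

Definition arc_time x : R := x.1%:R + x.2.

(* Its sticks are its edges, so a stick rail arc A has (size A).-1 sticks. *)
Definition stick_rail_arc A : Prop :=
  [/\ (1 < size A)%N,
      forall x y, arc_param A x -> arc_param A y ->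
        poly_pt A x = poly_pt A y -> arc_time x = arc_time y,
      rail1 (head 0 A), rail2 (last 0 A) &
      forall x, arc_param A x -> 0 < arc_time x < (size A).-1%:R ->
        ~ (rail1 `|` rail2) (poly_pt A x)].

(* The closed polygon A ++ B consists of the rail arc A, with projection kappa,
   followed by an arc from the end of A back to its start, with inner vertices
   B and projection alpha.  The alpha-edges are those of index at least
   (size A).-1.  At each crossing of alpha with kappa the height of alpha is
   below (resp. above) that of kappa.  The regularity of A ++ B includes that of kappa,
   so companions are those of rail arcs in general position.  The crossings of the immersed arc alpha
   with itself, if any, are resolved in the same way, each strand of alpha
   passing under (resp. over) all that precedes it; hence alpha carries no
   knotting of its own.  No alpha is excluded by lifting kappa to A itself,
   since alpha may be subdivided before its first and after its last
   crossing. *)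
Definition closes_with (ord : rel R) A B : Prop :=
  regular_projection (rail_dir L) (A ++ B) /\
  forall x y, closed_param (A ++ B) x -> closed_param (A ++ B) y ->
    (x.1 < y.1)%N -> ((size A).-1 <= y.1)%N ->
    proj (rail_dir L) (poly_pt (A ++ B) x) =
    proj (rail_dir L) (poly_pt (A ++ B) y) ->
    ord (height (poly_pt (A ++ B) y)) (height (poly_pt (A ++ B) x)).

Definition under_companion A K : Prop :=
  exists2 B, closes_with <%R A B & knot_equiv (A ++ B) K.

Definition over_companion A K : Prop :=
  exists2 B, closes_with >%R A B & knot_equiv (A ++ B) K.

Definition rail_stick_number K : nat :=
  nat_min [set n | exists A,
    [/\ stick_rail_arc A, under_companion A K \/ over_companion A K &
        size A = n.+1]].

End Rails.

(** Closed braids.  The braid on strands 0, 1, 2, ... is given by a word in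
    nonzero integers, read with increasing second coordinate: the letter i
    (resp. -i) exchanges the strands at positions i-1 and i, the one coming
    from the left passing over (resp. under).  The strand at position p and
    level k is at (2p, 2k, 0), crossings are made by lifting the over strand,
    and the closing strand at position p runs in the plane of first coordinate
    2p, below the braid. *)

Definition braid_move (c : int) (p : nat) : nat :=
  if p.+1 == `|c|%N then p.+1 else if p == `|c|%N then p.-1 else p.

Definition is_over (c : int) (p : nat) : bool :=
  (p.+1 == `|c|%N) && (0 < c) || (p == `|c|%N) && (c < 0).

Fixpoint braid_strand (w : seq int) (k p : nat) : seq (int * int * int) :=
  if w is c :: w' then
    (p.*2%:Z, k.*2%:Z, 0)
      :: (if is_over c p then [:: (`|c|.*2%:Z - 1, k.*2.+1%:Z, 1)] else [::])
      ++ braid_strand w' k.+1 (braid_move c p)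
  else [:: (p.*2%:Z, k.*2%:Z, 0); (p.*2%:Z, 0, -1)].

Definition braid_perm (w : seq int) (p : nat) : nat :=
  foldl (fun q c => braid_move c q) p w.

(* The component through position 0, going r times around: the whole closed
   braid if r is the number of strands and the closed braid is a knot. *)
Definition closed_braid (r : nat) (w : seq int) : seq (int * int * int) :=
  flatten [seq braid_strand w 0 p | p <- traject (braid_perm w) 0%N r].

Definition vec3 (R : realType) (v : int * int * int) : 'rV[R]_3 :=
  \row_(j < 3) [:: v.1.1%:~R; v.1.2%:~R; v.2%:~R]`_j.

Inductive rolfsen_name : Type :=
| K3_1 | K4_1 | K5_1 | K5_2 | K6_1 | K6_2 | K6_3
| K7_1 | K7_2 | K7_3 | K7_4 | K7_5 | K7_6 | K7_7
| K8_16 | K8_17 | K8_18 | K8_19 | K8_20 | K8_21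
| K9_29 | K9_34 | K9_40 | K9_41 | K9_42 | K9_44 | K9_46 | K9_47 | K9_49.

(* Number of strands and braid word.  Each closed braid is the knot of Rolfsen's
   table up to mirror image (the table itself does not separate mirror images;
   stick number and rail stick number are mirror invariant). *)
Definition rolfsen_braid (k : rolfsen_name) : nat * seq int :=
  match k with
  | K3_1 => (2%N, [:: 1; 1; 1])
  | K4_1 => (3%N, [:: 1; -2; 1; -2])
  | K5_1 => (2%N, [:: 1; 1; 1; 1; 1])
  | K5_2 => (3%N, [:: 1; 1; 1; 2; -1; 2])
  | K6_1 => (4%N, [:: 1; 1; 2; -1; -3; 2; -3])
  | K6_2 => (3%N, [:: 1; 1; 1; -2; 1; -2])
  | K6_3 => (3%N, [:: 1; 1; -2; 1; -2; -2])
  | K7_1 => (2%N, [:: 1; 1; 1; 1; 1; 1; 1])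
  | K7_2 => (4%N, [:: 1; 1; 1; 2; -1; 2; 3; -2; 3])
  | K7_3 => (3%N, [:: 1; 1; 1; 1; 1; 2; -1; 2])
  | K7_4 => (4%N, [:: 1; 1; 2; -1; 2; 2; 3; -2; 3])
  | K7_5 => (3%N, [:: 1; 1; 1; 1; 2; -1; 2; 2])
  | K7_6 => (4%N, [:: 1; 1; -2; 1; 3; -2; 3])
  | K7_7 => (4%N, [:: 1; -2; 1; -2; 3; -2; 3])
  | K8_16 => (3%N, [:: 1; 1; -2; 1; 1; -2; 1; -2])
  | K8_17 => (3%N, [:: 1; 1; -2; 1; -2; 1; -2; -2])
  | K8_18 => (3%N, [:: 1; -2; 1; -2; 1; -2; 1; -2])
  | K8_19 => (3%N, [:: 1; 1; 1; 2; 1; 1; 1; 2])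
  | K8_20 => (3%N, [:: 1; 1; 1; -2; -1; -1; -1; -2])
  | K8_21 => (3%N, [:: 1; 1; 1; 2; -1; -1; 2; 2])
  | K9_29 => (4%N, [:: 1; -2; -2; 3; -2; 1; -2; 3; -2])
  | K9_34 => (4%N, [:: 1; -2; 1; -2; 3; -2; 1; -2; 3])
  | K9_40 => (4%N, [:: 1; 3; -2; 1; 3; -2; 1; 3; -2])
  | K9_41 => (5%N, [:: -1; -1; -2; 1; 3; 2; 2; -4; -3; 2; -3; -4])
  | K9_42 => (4%N, [:: 1; 1; 1; -2; -1; -1; 3; -2; 3])
  | K9_44 => (4%N, [:: 1; 1; 1; 2; -1; -1; -3; 2; -3])
  | K9_46 => (4%N, [:: -1; 2; -1; 2; -3; -2; 1; -2; -3])
  | K9_47 => (4%N, [:: 1; 2; -3; 2; -3; 1; 2; -3; 2])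
  | K9_49 => (4%N, [:: 1; 1; 2; 1; 1; -3; 2; -1; 2; 3; 3])
  end.

Definition rolfsen_knot (R : realType) (k : rolfsen_name) : seq 'rV[R]_3 :=
  [seq vec3 R v | v <- closed_braid (rolfsen_braid k).1 (rolfsen_braid k).2].

(* Main.v *)
Require Import Defs.
From mathcomp Require Import all_boot all_order all_algebra.
From mathcomp Require Import boolp classical_sets reals.
From mathcomp Require Import topology normedtype derive.
From mathcomp Require Import ring lra zify.
Set Implicit Arguments.
Unset Strict Implicit.
Unset Printing Implicit Defensive.
Import Order.TTheory GRing.Theory Num.Theory.
Import numFieldNormedType.Exports.
Local Open Scope classical_set_scope.
Local Open Scope ring_scope.

(** The rail arcs and the stick knots in a class correspond to each other in such
    a way that a rail arc has two sticks less than the stick knot; the two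
    minima are compared without computing either.

    From a knot to an arc: a knot with n sticks has an exposed vertex v, for
    instance one that is farthest from the origin ([exposed_vertex]).  A
    projective map that sends a plane touching the knot only at v to infinity
    turns the two sticks at v into parallel rays with a common direction and
    the other n - 2 sticks into an arc between the lines that carry these rays.
    These lines are the rails, and closing the arc along the rays,
    above everything else, gives an over companion.  Conversely, closing a rail
    arc with n sticks by two rays that point away from it in the direction of the
    rails, and bringing their common point at infinity to a finite position by
    a projective map, gives a knot with n + 2 sticks.

    The common part of both directions is [cone_closure].  A companion is
    given by an arc that runs below (or above) the rail arc and may wander in
    projection.  A perspectivity that brings the point at infinity below to a
    finite apex turns the curtain hanging from an edge of that arc into a
    triangle.  The curtains miss everything that runs higher, so the vertices
    of the arc are inserted or removed one at a time by triangle moves, until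
    only the apex is left.

    Projective maps with positive determinant and positive denominators preserve
    the knot class ([knot_transvection]), because they are joined to the
    identity and the class is constant along an isotopy of stick knots
    ([isotopy]).  This rests on stability: polygons close to a stick knot are
    stick knots in the same class ([knot_stable]), since embeddedness is an open
    condition and one vertex can be moved by two triangle moves
    ([vertex_move]).  Stability also allows the perturbation to general
    position ([perturb_regular]) under which the projection of the arc is
    regular.  Finally the arc must end on the prescribed rails, and
    linear maps that preserve knot classes take any two independent vectors to
    any two others ([move_pair]). *)

(** * Stick knots as cyclic sequences of half-open edges *)

Section Edges.
Context {R : realType}.
Local Notation V := 'rV[R]_3.
Implicit Types (s l : seq V) (a b c p q v w x y : V) (e : V * V) (t : R).

(** The final point is left out because it starts the next edge: in a knot the
    half-open edges are disjoint, consecutive ones included. *)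
Definition half_edge e : set V :=
  [set p | exists t, [/\ 0 <= t, t < 1 & p = e.1 + t *: (e.2 - e.1)]].

Fixpoint path_edges x l : seq (V * V) :=
  if l is y :: l' then (x, y) :: path_edges y l' else [::].

Definition edges s : seq (V * V) :=
  if s is x :: l then path_edges x (rcons l x) else [::].

Definition disj_edges e e' : Prop :=
  forall p, half_edge e p -> half_edge e' p -> False.

Definition simple (es : seq (V * V)) : bool :=
  all (fun e => e.1 != e.2) es && pairwise (fun e e' => `[< disj_edges e e' >]) es.

Lemma path_edges_cat x l1 l2 :
  path_edges x (l1 ++ l2) = path_edges x l1 ++ path_edges (last x l1) l2.
Proof. by elim: l1 x => //= y l1 IH x; rewrite IH. Qed.

Lemma path_edges_rcons x l y :
  path_edges x (rcons l y) = rcons (path_edges x l) (last x l, y).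
Proof. by rewrite -cats1 path_edges_cat /= cats1. Qed.

Lemma size_path_edges x l : size (path_edges x l) = size l.
Proof. by elim: l x => //= y l IH x; rewrite IH. Qed.

Lemma size_edges s : size (edges s) = size s.
Proof. by case: s => //= x l; rewrite size_path_edges size_rcons. Qed.

Lemma nth_path_edges x l i : (i < size l)%N ->
  nth (0, 0) (path_edges x l) i = (nth 0 (x :: l) i, nth 0 l i).
Proof. by elim: l x i => //= y l IH x [|i] //= /IH->. Qed.

Lemma nth_edges s i : (i < size s)%N ->
  nth (0, 0) (edges s) i = (nth 0 s i, nth 0 s (i.+1 %% size s)).
Proof.
case: s => //= x l ilt; rewrite nth_path_edges ?size_rcons //.
rewrite -rcons_cons nth_rcons /= ilt nth_rcons.
case: (ltngtP i (size l)) => [h|h|->]; last by rewrite modnn.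
  by rewrite modn_small.
by move: ilt; rewrite ltnS leqNgt h.
Qed.

Lemma poly_pt_edge s (y : nat * R) : (y.1 < size s)%N -> poly_pt s y =
  (nth (0, 0) (edges s) y.1).1
   + y.2 *: ((nth (0, 0) (edges s) y.1).2 - (nth (0, 0) (edges s) y.1).1).
Proof. by move=> h; rewrite nth_edges //=. Qed.

Lemma edges_rot n s : edges (rot n s) = rot n (edges s).
Proof.
have [nlt|nge] := ltnP n (size s); last first.
  by rewrite !rot_oversize ?size_edges.
have h : take n s ++ drop n s = s by rewrite cat_take_drop.
have hn : size (take n s) = n by rewrite size_takel // ltnW.
rewrite /rot; move: h hn; move: (take n s) (drop n s) => u d; case: d => [|d0 d].
  by rewrite cats0 => us un; move: nlt; rewrite -us un ltnn.
move=> <- {nlt} <-; case: u => [|u0 u] /=; first by rewrite drop0 take0 !cats0.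
rewrite !rcons_cat /= -cat_rcons -[u ++ _]cat_rcons !path_edges_cat !last_rcons.
by rewrite drop_size_cat ?take_size_cat // size_path_edges size_rcons.
Qed.

Lemma half_edge_start e : half_edge e e.1.
Proof. by exists 0; rewrite scale0r addr0. Qed.

Lemma disj_edgesC e e' : `[< disj_edges e e' >] = `[< disj_edges e' e >].
Proof. by apply/asboolP/asboolP => h p h1 h2; exact: (h p h2 h1). Qed.

Lemma simple_rot n es : simple (rot n es) = simple es.
Proof.
rewrite -{2}(cat_take_drop n es) /rot /simple !all_cat !pairwise_cat allrelC.
rewrite [allrel _ _ _](_ : _ = allrel (fun e e' => `[< disj_edges e e' >]) (take n es) (drop n es)).
  by rewrite [all _ _ && all _ _]andbC [pairwise _ _ && pairwise _ _]andbC.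
by apply: eq_allrel => e e'; rewrite disj_edgesC.
Qed.

Lemma simple_cat es es' : simple (es ++ es') =
  [&& simple es, simple es' & allrel (fun e e' => `[< disj_edges e e' >]) es es'].
Proof.
rewrite /simple all_cat pairwise_cat.
by case: (all _ es); case: (all _ es'); case: (allrel _ _ _) => //=;
  rewrite ?andbF ?andbT.
Qed.

Lemma simple_cons e es : simple (e :: es) =
  [&& e.1 != e.2, simple es & all (fun e' => `[< disj_edges e e' >]) es].
Proof.
rewrite /simple /= -!andbA; congr andb; congr andb.
by rewrite andbC.
Qed.

Lemma simple_disj es i j : simple es -> (i < size es)%N -> (j < size es)%N ->
  i <> j -> disj_edges (nth (0, 0) es i) (nth (0, 0) es j).
Proof.
move=> /andP[_ /(pairwiseP (0, 0)) h] ilt jlt.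
move=> /eqP; rewrite neq_ltn => /orP[ij|ij].
  by have /asboolP := h i j ilt jlt ij.
by have := h j i jlt ilt ij; rewrite disj_edgesC => /asboolP.
Qed.

Lemma edge_inj e t t' : e.1 != e.2 ->
  e.1 + t *: (e.2 - e.1) = e.1 + t' *: (e.2 - e.1) -> t = t'.
Proof.
move=> ne /addrI /eqP; rewrite -subr_eq0 -scalerBl scaler_eq0 !subr_eq0.
by rewrite [e.2 == _]eq_sym (negPf ne) orbF => /eqP.
Qed.

(** The half-open edges partition the parameters, so injectivity splits into
    a condition on each edge and a condition on each pair of edges, and no
    exception is needed for consecutive edges. *)
Lemma stick_knotE s : stick_knot s <-> s != [::] /\ simple (edges s).
Proof.
split=> [[s0 inj]|[s0 sim]].
  split; first by rewrite -size_eq0 -lt0n.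
  rewrite /simple; apply/andP; split.
    apply/(all_nthP (0, 0)) => i; rewrite size_edges => ilt; apply/eqP => ee.
    have h0 : closed_param s (i, 0) by split=> //=; lra.
    have h1 : closed_param s (i, 2^-1) by split=> //=; lra.
    have := inj _ _ h0 h1; rewrite !poly_pt_edge //= ee !subrr !scaler0 => /(_ erefl) [].
    lra.
  apply/(pairwiseP (0, 0)) => i j; rewrite !inE size_edges => ilt jlt ij.
  move=> p [t [t0 t1 ->]] [u [u0 u1 pu]].
  have h0 : closed_param s (i, t) by split=> //=; rewrite t0.
  have h1 : closed_param s (j, u) by split=> //=; rewrite u0.
  have := inj _ _ h0 h1; rewrite !poly_pt_edge //= pu => /(_ erefl) [eij _].
  by move: ij; rewrite eij ltnn.
split; first by rewrite lt0n size_eq0.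
move=> [i t] [j u] [/= ilt /andP[t0 t1]] [/= jlt /andP[u0 u1]].
rewrite !poly_pt_edge //= => eqp.
have eij : i = j.
  apply: contrapT => ij; apply: (simple_disj sim _ _ ij) (ex_intro _ t _) (ex_intro _ u _).
  - by rewrite size_edges.
  - by rewrite size_edges.
  - by split.
  - by split.
move: eqp; rewrite -eij => /edge_inj -> //.
by case/andP: sim => /(all_nthP (0, 0)) h _; apply: h; rewrite size_edges.
Qed.

Lemma traceE s p : trace s p <-> exists2 e, e \in edges s & half_edge e p.
Proof.
split=> [[[i t] [/= ilt /andP[t0 t1]] ->]|[e /(nthP (0, 0)) [i]]].
  rewrite poly_pt_edge //=; exists (nth (0, 0) (edges s) i).
    by rewrite mem_nth ?size_edges.
  by exists t.
rewrite size_edges => ilt <- [t [t0 t1 pe]]; exists (i, t) => //=.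
  by split=> //=; rewrite t0.
by rewrite poly_pt_edge.
Qed.

Lemma stick_knot_rot n s : stick_knot s -> stick_knot (rot n s).
Proof.
rewrite !stick_knotE edges_rot simple_rot => -[s0 h]; split=> //.
by move: s0; rewrite -!size_eq0 size_rot.
Qed.

(** A digon runs twice over the same segment. *)
Lemma stick_knot_size s : stick_knot s -> (2 < size s)%N.
Proof.
rewrite stick_knotE => -[]; case: s => [|a [|b [|c s]]] //= _.
  by rewrite !simple_cons /= eqxx.
rewrite !simple_cons /= => /and3P[ab _]; rewrite andbT => /asboolP h.
exfalso; apply: (h (a + 2^-1 *: (b - a))).
  by exists 2^-1; split=> //; lra.
exists 2^-1; split; [lra|lra|].
by apply/rowP => i; rewrite !mxE; field.
Qed.

Lemma stick_knot_uniq s : stick_knot s -> uniq s.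
Proof.
move=> [s0 inj]; apply/(uniqP 0) => i j; rewrite !inE => ilt jlt eqn.
have h0 : closed_param s (i, 0) by split=> //=; lra.
have h1 : closed_param s (j, 0) by split=> //=; lra.
by have := inj _ _ h0 h1; rewrite /poly_pt /= !scale0r !addr0 => /(_ eqn) [].
Qed.

End Edges.

(** * Moving one vertex by two triangle moves *)

Section VertexMove.
Context {R : realType}.
Local Notation V := 'rV[R]_3.
Implicit Types (s l : seq V) (a b c p q v w x y z : V) (e : V * V) (t : R).

(** Column vectors serve as linear forms, so that a dual basis is an inverse
    matrix. *)
Definition lf (g : 'cV[R]_3) p : R := (p *m g) 0 0.

Lemma lfD g p q : lf g (p + q) = lf g p + lf g q.
Proof. by rewrite /lf mulmxDl mxE. Qed.

Lemma lfZ g t p : lf g (t *: p) = t * lf g p.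
Proof. by rewrite /lf -scalemxAl mxE. Qed.

Lemma lfN g p : lf g (- p) = - lf g p.
Proof. by rewrite -scaleN1r lfZ mulN1r. Qed.

Lemma lfB g p q : lf g (p - q) = lf g p - lf g q.
Proof. by rewrite lfD lfN. Qed.

Lemma lfv0 g : lf g 0 = 0.
Proof. by rewrite /lf mul0mx mxE. Qed.

Lemma lfNg g p : lf (- g) p = - lf g p.
Proof. by rewrite /lf mulmxN mxE. Qed.

Definition lfE := (lfD, lfN, lfZ).

Lemma half_segment a b z : half_edge (a, b) z -> segment a b z.
Proof.
move=> [t [t0 t1 ->]]; exists t; split=> //; first exact: ltW.
by apply/rowP=> i; rewrite !mxE /=; ring.
Qed.

Lemma segment_half a b z : segment a b z -> half_edge (a, b) z \/ z = b.
Proof.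
move=> [t [t0 t1 ->]]; have [->|t1'] := eqVneq t 1.
  by right; rewrite subrr scale0r add0r scale1r.
left; exists t; split=> //=; first by rewrite lt_neqAle t1'.
by apply/rowP=> i; rewrite !mxE; ring.
Qed.

(** Isolates the two edges at the first vertex, the only ones that change when
    that vertex moves. *)
Lemma stick_cone p b l : let a := last b l in
  stick_knot (p :: b :: l) <->
  [/\ p <> b, a <> p, simple (path_edges b l), disj_edges (p, b) (a, p) &
      forall e, e \in path_edges b l -> disj_edges (p, b) e /\ disj_edges e (a, p)].
Proof.
move=> a; rewrite stick_knotE /= simple_cons path_edges_rcons -cats1 simple_cat.
rewrite simple_cons /= andbT allrel1r all_cat /= andbT.
split=> [[_ /and4P[/eqP pb /and3P[sim /eqP ap /allP h1] /allP h2 /asboolP h3]]|].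
  split=> // e ein; split; apply/asboolP; [exact: h2|exact: h1].
move=> [/eqP pb /eqP ap sim h3 h]; split=> //; rewrite pb ap sim /=.
apply/and3P; split; last exact/asboolP.
  by apply/allP => e /h[_ ?]; apply/asboolP.
by apply/allP => e /h[? _]; apply/asboolP.
Qed.

Lemma path_edges_head b l : l != [::] ->
  exists2 e, e \in path_edges b l & half_edge e b.
Proof.
case: l => // c l _; exists (b, c); first by rewrite /= mem_head.
exact: half_edge_start.
Qed.

(** Move v to w through the triangles w v b and a v w, where a and b are the
    neighbours of v.  Each of these triangles is a union of segments from a
    point of [v, w] to b, respectively to a, and such a segment is an edge of
    a polygon known to be embedded; hence the triangles can meet only the two
    edges at the moving vertex.  The form g, constant on a, b and v but not
    on w, excludes that: w lies off a plane through a, b and v. *)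
Lemma vertex_move v w b l g : l != [::] ->
  (forall t, 0 <= t -> t <= 1 -> stick_knot ((v + t *: (w - v)) :: b :: l)) ->
  lf g b = lf g v -> lf g (last b l) = lf g v -> lf g w <> lf g v ->
  knot_equiv (v :: b :: l) (w :: b :: l).
Proof.
move=> l0 stk gb ga gw; set a := last b l in ga.
have stv : stick_knot (v :: b :: l).
  by move: (stk 0); rewrite scale0r addr0; apply.
have stw : stick_knot (w :: b :: l).
  by move: (stk 1); rewrite scale1r addrC subrK; apply.
have [vb av sim dv hv] := (stick_cone v b l).1 stv; rewrite -/a in av dv hv.
have [wb aw _ dw hw] := (stick_cone w b l).1 stw; rewrite -/a in aw dw hw.
have [e0 e0in e0b] := path_edges_head b l0.
have hp t : 0 <= t -> t <= 1 -> let p := v + t *: (w - v) in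
    forall e, e \in path_edges b l -> disj_edges (p, b) e /\ disj_edges e (a, p).
  by move=> t0 t1 p; have [] := (stick_cone p b l).1 (stk _ t0 t1).
have wv0 : lf g w - lf g v != 0 by rewrite subr_eq0; apply/eqP.
have vw : v <> w by move=> vw; apply: gw; rewrite vw.
have abseg z : segment a v z -> z = b -> False.
  move=> /segment_half[h zb|->]; last exact: vb.
  by apply: (hv _ e0in).2 (e0b) _; rewrite -zb.
have bav k m : 0 <= k -> 0 <= m -> 0 < k + m ->
    k *: a + m *: v = (k + m) *: b -> False.
  move=> k0 m0 km eq; apply: (abseg b) => //; exists (m / (k + m)); split.
  - by rewrite divr_ge0 // ltW.
  - by rewrite ler_pdivrMr // mul1r; lra.
  have -> : b = (k + m)^-1 *: ((k + m) *: b).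
    by rewrite scalerA mulVf ?scale1r // gt_eqF.
  by rewrite -eq; apply/rowP=> i; rewrite !mxE; field; rewrite gt_eqF.
have stX : stick_knot (v :: w :: b :: l).
  apply/stick_cone; rewrite -/a; split=> //.
  - rewrite simple_cons /= sim; apply/and3P; split=> //; first exact/eqP.
    by apply/allP => e /hw[h _]; apply/asboolP.
  - move=> p [t /= [t0 t1 ->]] [u /= [u0 u1 eq]].
    have := congr1 (lf g) eq; rewrite !lfE ga subrr mulr0 addr0 => E.
    have : t * (lf g w - lf g v) = 0 by lra.
    move=> /eqP; rewrite mulf_eq0 (negPf wv0) orbF => /eqP t00.
    move: eq; rewrite t00 scale0r addr0 => eq; apply: av.
    suff : (1 - u) *: (v - a) = 0.
      move=> /eqP; rewrite scaler_eq0 subr_eq0 => /orP[/eqP u1'|].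
        by move: u1; rewrite -u1' ltxx.
      by rewrite subr_eq0 => /eqP.
    rewrite scalerBl scale1r; apply/eqP; rewrite subr_eq0; apply/eqP.
    by rewrite {1}eq addrC addKr.
  - move=> e /=; rewrite inE => /orP[/eqP->|ein]; split.
    + move=> p [t /= [t0 t1 ->]] [u /= [u0 u1 eq]].
      have := congr1 (lf g) eq; rewrite !lfE gb => E.
      have : (t - (1 - u)) * (lf g w - lf g v) = 0 by lra.
      move=> /eqP; rewrite mulf_eq0 (negPf wv0) orbF => /eqP t00.
      have tE : t = 1 - u by lra.
      apply: vb; suff : u *: (v - b) = 0.
        move=> /eqP; rewrite scaler_eq0 subr_eq0 => /orP[/eqP u0'|/eqP //].
        by move: t1; rewrite tE u0' subr0 ltxx.
      move: eq; rewrite tE => eq; apply/rowP => i; move/rowP: eq => /(_ i).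
      rewrite !mxE => eq; lra.
    + move=> p [t /= [t0 t1 ->]] [u /= [u0 u1 eq]].
      have := congr1 (lf g) eq; rewrite !lfE ga gb => E.
      have : (1 - t) * (lf g w - lf g v) = 0 by lra.
      move=> /eqP; rewrite mulf_eq0 (negPf wv0) orbF => /eqP; lra.
    + move=> p [t /= [t0 t1 pE]] pe.
      apply: (hp t t0 (ltW t1) e ein).1 pe; rewrite pE; exact: (half_edge_start (_, _)).
    + exact: (hv e ein).2.
have tri1 : knot_equiv (b :: rcons l v) (w :: b :: rcons l v).
  apply: KnotTriangle.
  - by have := stick_knot_rot 1 stv; rewrite rot1_cons.
  - by have := stick_knot_rot 1 stX; rewrite rot1_cons.
  move=> z [/traceE[e]]; rewrite /= !path_edges_rcons !last_rcons -/a.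
  rewrite !mem_rcons !inE mem_rcons !inE.
  move=> ein ez [t [u [k [[t0 u0 k0] tuk zE]]]].
  case/or3P: ein => [/eqP ee|/eqP ee|ein].
  - by apply: half_segment; rewrite -ee.
  - move: ez; rewrite ee => -[m /= [m0 m1 zE']].
    have := congr1 (lf g) zE; rewrite zE' !lfE ga gb => E.
    have : u * (lf g w - lf g v) = 0.
      have -> : u * (lf g w - lf g v) = u * lf g w - u * lf g v by ring.
      have : (t + u + k) * lf g v = lf g v by rewrite tuk mul1r.
      lra.
    move=> /eqP; rewrite mulf_eq0 (negPf wv0) orbF => /eqP u00.
    exists k; split=> //; first lra.
    by rewrite -zE' zE u00 scale0r addr0; congr (_ *: _ + _); lra.
  - have [tu0|tu0] := eqVneq (t + u) 0.
      have t00 : t = 0 by lra.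
      have u00 : u = 0 by lra.
      exists 1; split; [lra|lra|]; rewrite zE t00 u00; congr (_ + _ *: _).
        by rewrite !scale0r addr0 subrr scale0r.
      by lra.
    have tup : 0 < t + u by lra.
    have m0 : 0 <= u / (t + u) by rewrite divr_ge0 // ltW.
    have m1 : u / (t + u) <= 1 by rewrite ler_pdivrMr // mul1r; lra.
    exfalso; apply: (hp _ m0 m1 e ein).1 ez; exists k; split=> //=; first lra.
    have -> : k = 1 - (t + u) by lra.
    by rewrite zE (_ : k = 1 - (t + u)); [apply/rowP=> i; rewrite !mxE; field|lra].
have tri2 : knot_equiv (w :: b :: l) (v :: w :: b :: l).
  apply: KnotTriangle => // z [/traceE[e]].
  rewrite /= !path_edges_rcons -/a !inE !mem_rcons !inE.
  move=> ein ez [t [u [k [[t0 u0 k0] tuk zE]]]].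
  case/or3P: ein => [/eqP ee|/eqP ee|ein].
  - move: ez; rewrite ee => -[m /= [m0 m1 zE']].
    have kE : k = 1 - t - u by lra.
    have := congr1 (lf g) zE; rewrite zE' !lfE ga gb => E.
    have : (t + u - m) * (lf g w - lf g v) = 0.
      have -> : (t + u - m) * (lf g w - lf g v) =
        (lf g w + m * (lf g v - lf g w)) -
        (t * lf g v + u * lf g v + (1 - t - u) * lf g w) by ring.
      by rewrite E kE subrr.
    move=> /eqP; rewrite mulf_eq0 (negPf wv0) orbF => /eqP mE.
    have [tu0|tu0] := eqVneq (t + u) 0.
      have t00 : t = 0 by lra.
      have u00 : u = 0 by lra.
      exists 1; split; [lra|lra|]; rewrite -zE' zE t00 u00; congr (_ + _ *: _).
        by rewrite !scale0r addr0 subrr scale0r.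
      by lra.
    exfalso; apply: (bav t u) => //; first lra.
    have mE' : m = t + u by lra.
    apply/rowP => i; have := congr1 (fun x : V => x 0 i) zE.
    by rewrite zE' mE' kE !mxE; lra.
  - by apply: half_segment; rewrite -ee.
  - have [tu0|tu0] := eqVneq t 1.
      have k00 : k = 0 by lra.
      have u00 : u = 0 by lra.
      exists 0; split; [lra|lra|].
      by rewrite zE tu0 k00 u00 !scale0r subr0 !addr0.
    have kup : 0 < k + u by lra.
    have m0 : 0 <= k / (k + u) by rewrite divr_ge0 // ltW.
    have m1 : k / (k + u) <= 1 by rewrite ler_pdivrMr // mul1r; lra.
    have zp : z = a + (k + u) *: (v + (k / (k + u)) *: (w - v) - a).
      rewrite zE (_ : t = 1 - (k + u)); last lra.
      by apply/rowP=> i; rewrite !mxE; field; rewrite gt_eqF.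
    have : segment a (v + (k / (k + u)) *: (w - v)) z.
      exists (k + u); split; [lra|lra|].
      by rewrite zp; apply/rowP=> i; rewrite !mxE; ring.
    case/segment_half => [h|zp']; exfalso.
      exact: (hp _ m0 m1 e ein).2 ez h.
    apply: (hp _ m0 m1 e ein).1 ez; rewrite zp'.
    exact: (half_edge_start (_, _)).
apply: (KnotTrans (KnotRot 1 _)); rewrite rot1_cons /=.
apply: (KnotTrans tri1); apply: (KnotTrans (KnotSym _) (KnotSym tri2)).
have -> : w :: b :: rcons l v = rot 1 (v :: w :: b :: l) by rewrite rot1_cons.
exact: KnotRot.
Qed.
End VertexMove.

(** * Avoiding planes, and a gap for segments *)

Section Generic.
Context {R : realType}.
Local Notation V := 'rV[R]_3.

Definition close (eps : R) (p q : V) : Prop := forall j, `|p 0 j - q 0 j| < eps.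

Lemma poly_small_nonroot (P : {poly R}) (eta : R) : P != 0 -> 0 < eta ->
  exists t, [/\ 0 < t, t < eta & P.[t] != 0].
Proof.
move=> P0 eta0; apply: contrapT => h.
pose f (j : nat) : R := eta / (j%:R + 2).
have fpos j : 0 < (j%:R + 2 : R) by rewrite ltr_wpDl.
have finj : injective f.
  move=> i j /(mulfI (lt0r_neq0 eta0)) /invr_inj /addIr /eqP.
  by rewrite eqr_nat => /eqP.
have := max_poly_roots (rs := [seq f j | j <- iota 0 (size P)]) P0.
rewrite size_map size_iota ltnn => /(_ _ _)/negP; apply => //; last first.
  by rewrite map_inj_uniq // iota_uniq.
apply/allP => _ /mapP[j _ ->]; apply/rootP/eqP/negPn/negP => nz; apply: h.
exists (f j); split=> //; first exact: divr_gt0.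
rewrite ltr_pdivrMr // ltr_pMr //; have : 0 <= j%:R :> R by []. lra.
Qed.

Lemma lf_sum (g : 'cV[R]_3) (p : V) : lf g p = \sum_j p 0 j * g j 0.
Proof. by rewrite /lf mxE. Qed.

Lemma sum3 (F : 'I_3 -> R) : \sum_j F j = F 0 + F 1 + F 2%:R.
Proof.
rewrite !big_ord_recl big_ord0 addr0 addrA.
by congr (_ + F _ + F _); exact: val_inj.
Qed.

(** The point is found on the curve p0 + (t, t^2, t^3): a nonzero affine
    function restricts to a nonzero polynomial in t there, so finitely many
    planes meet the curve in finitely many points. *)
Lemma avoid_planes (I : finType) (P : pred I) (g : I -> 'cV[R]_3) (k : I -> R)
    (p0 : V) (eps : R) :
  (forall i, P i -> g i != 0 \/ k i != 0) -> 0 < eps ->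
  exists2 p, close eps p p0 & forall i, P i -> lf (g i) p + k i != 0.
Proof.
move=> nz eps0.
pose Q i := Poly [:: lf (g i) p0 + k i; g i 0 0; g i 1 0; g i 2%:R 0].
have Q0 : \prod_(i | P i) Q i != 0.
  apply/prodf_neq0 => i Pi; apply/eqP => Qi0.
  have coef j := congr1 (fun q : {poly R} => q`_j) Qi0.
  have := (coef 1, coef 2, coef 3)%N; rewrite !coef_Poly !coef0 /= => -[[c1 c2] c3].
  have gi0 : g i = 0.
    apply/colP => j; rewrite mxE; case: j => -[|[|[|//]]] lt3; [
      rewrite -c1|rewrite -c2|rewrite -c3]; congr (g i _ _); exact: val_inj.
  have := coef 0%N; rewrite coef_Poly coef0 /= gi0 lf_sum big1 ?add0r => [ki0|j _].
    by have [] := nz i Pi; rewrite ?gi0 ?ki0 eqxx.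
  by rewrite mxE mulr0.
have eta0 : 0 < Num.min eps 1 by rewrite lt_min eps0 ltr01.
have [t [t0 teta Qt]] := poly_small_nonroot Q0 eta0.
have [te t1] : t < eps /\ t < 1 by apply/andP; rewrite -lt_min.
exists (p0 + \row_(j < 3) t ^+ j.+1).
  move=> j; rewrite !mxE [X in `|X|](_ : _ = t ^+ j.+1); last by ring.
  rewrite ger0_norm; last by rewrite exprn_ge0 // ltW.
  apply: le_lt_trans te; rewrite exprS ler_piMr; [by []|exact: ltW|].
  by rewrite exprn_ile1 // ltW.
move=> i Pi; move: Qt; rewrite horner_prod => /prodf_neq0 /(_ i Pi).
rewrite horner_Poly /= lfD => /eqP nzt; apply/eqP => h; apply: nzt.
by rewrite -[RHS]h !lf_sum !sum3 !mxE /=; ring.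
Qed.

Lemma annihilator (u w : V) : exists2 g : 'cV[R]_3, g != 0 & lf g u = 0 /\ lf g w = 0.
Proof.
pose M := col_mx u w.
have : cokermx M != 0.
  rewrite -mxrank_eq0 mxrank_coker subn_eq0 -ltnNge.
  exact: leq_ltn_trans (rank_leq_row M) _.
move=> /matrix0Pn[i [j nz]]; exists (col j (cokermx M)).
  by apply/matrix0Pn; exists i, 0; rewrite mxE.
have : M *m col j (cokermx M) = 0 by rewrite colE mulmxA mulmx_coker mul0mx.
by rewrite mul_col_mx -[0]col_mx0 => /eq_col_mx[h1 h2]; rewrite /lf h1 h2 mxE.
Qed.

(** By compactness of the parameter square the squared length stays above some
    mu > 0, hence at each parameter one coordinate is at least min(1, mu) / 3
    in absolute value, more than the perturbation can change it. *)
Lemma gap (c0 c1 c2 : V) :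
  (forall t u, 0 <= t <= 1 -> 0 <= u <= 1 -> c0 + t *: c1 + u *: c2 <> 0) ->
  exists2 eps, 0 < eps & forall d0 d1 d2,
    close eps c0 d0 -> close eps c1 d1 -> close eps c2 d2 ->
    forall t u, 0 <= t <= 1 -> 0 <= u <= 1 -> d0 + t *: d1 + u *: d2 <> 0.
Proof.
move=> nz.
pose X j (v : 'rV[R]_2) : R := c0 0 j + v 0 0 * c1 0 j + v 0 1 * c2 0 j.
pose f (v : 'rV[R]_2) : R := \sum_j X j v ^+ 2.
pose A := [set v : 'rV[R]_2 | forall i, `[0, 1]%classic (v ord0 i)].
have cA : compact A.
  by apply: (@rV_compact R 2 (fun=> `[0, 1]%classic)) => _; exact: segment_compact.
have A0 : A !=set0 by exists 0 => i; rewrite /= mxE in_itv /= lexx ler01.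
have cX j : continuous (X j).
  have cc (i : 'I_2) : continuous (fun v : 'rV[R]_2 => v 0 i).
    by move=> v; exact: coord_continuous.
  have ck (k : R) : continuous (fun _ : 'rV[R]_2 => k) by move=> v; apply: cst_continuous.
  move=> v; apply: (continuousD (f := fun v : 'rV[R]_2 => c0 0 j + v 0 0 * c1 0 j)
    (g := fun v : 'rV[R]_2 => v 0 1 * c2 0 j)).
    apply: (continuousD (f := fun v : 'rV[R]_2 => c0 0 j)) => //; first exact: ck.
    by apply: (continuousM (s := fun v : 'rV[R]_2 => v 0 0)); [exact: cc|exact: ck].
  by apply: (continuousM (s := fun v : 'rV[R]_2 => v 0 1)); [exact: cc|exact: ck].
have cf : continuous f.
  have cX2 j : continuous (fun v => X j v * X j v).
    by move=> v; apply: continuousM; exact: cX.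
  have -> : f = (fun v => X 0 v * X 0 v + X 1 v * X 1 v + X 2%:R v * X 2%:R v).
    by apply/funext => v; rewrite /f sum3 !expr2.
  move=> v; apply: (continuousD (f := fun v => X 0 v * X 0 v + X 1 v * X 1 v));
    last exact: cX2.
  by apply: (continuousD (f := fun v => X 0 v * X 0 v)); exact: cX2.
have [v0 v0A vmin] := EVT_min_rV A0 cA (continuous_subspaceT cf).
have in01 (t : R) : (t \in `[0, 1]) = (0 <= t <= 1) by rewrite in_itv.
have fpos : 0 < f v0.
  rewrite lt_neqAle sumr_ge0 ?andbT; last by move=> j _; exact: sqr_ge0.
  apply/eqP => /esym/psumr_eq0P h.
  have := set_mem v0A => v0A'.
  apply: (nz (v0 0 0) (v0 0 1)).
  - by have := v0A' 0; rewrite /= in_itv.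
  - by have := v0A' 1; rewrite /= in_itv.
  apply/rowP => j; have /eqP := h (fun j _ => sqr_ge0 _) j erefl.
  by rewrite sqrf_eq0 /X => /eqP; rewrite !mxE.
pose eta := Num.min 1 (f v0) / 3.
have eta0 : 0 < eta by rewrite divr_gt0 // lt_min ltr01.
have [eta1 eta2] : eta <= 3^-1 /\ 3 * eta <= f v0.
  rewrite /eta; have [h|h] := leP 1 (f v0); split; lra.
exists (eta / 3); first exact: divr_gt0.
move=> d0 d1 d2 h0 h1 h2 t u t01 u01 eq.
pose v : 'rV[R]_2 := \row_j (if j == 0 then t else u).
have vA : v \in A.
  by rewrite inE => i; rewrite /= mxE in_itv /=; case: ifP.
have := vmin _ vA; apply/negP; rewrite -ltNge; apply: lt_le_trans eta2.
have -> : 3 * eta = \sum_(j < 3) eta by rewrite sumr_const card_ord mulr_natl.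
apply: ltr_sum; first by apply/hasP; exists 0; rewrite ?mem_index_enum.
move=> j _; have := congr1 (fun v : V => v 0 j) eq; rewrite !mxE => eqj.
have := h0 j; have := h1 j; have := h2 j; rewrite /X !mxE /=.
rewrite !ltr_norml => /andP[a1 a2] /andP[b1 b2] /andP[e1 e2].
set x := (X in X ^+ 2).
have xE : x = (c0 0 j - d0 0 j) + t * (c1 0 j - d1 0 j) + u * (c2 0 j - d2 0 j).
  by rewrite /x; lra.
case/andP: t01 => t0 t1; case/andP: u01 => u0 u1.
have B (w k : R) : 0 <= w -> w <= 1 -> - (eta / 3) < k -> k < eta / 3 ->
    - (eta / 3) <= w * k <= eta / 3.
  move=> w0 w1 k0 k1; apply/andP; split; nra.
have /andP[B1 B2] := B _ _ t0 t1 b1 b2.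
have /andP[B3 B4] := B _ _ u0 u1 a1 a2.
have [xl xu] : - eta < x /\ x < eta by rewrite xE; split; lra.
rewrite expr2; nra.
Qed.

End Generic.

(** * Small perturbations of a stick knot *)

Section Stability.
Context {R : realType}.
Local Notation V := 'rV[R]_3.
Implicit Types (s l : seq V) (a b c p q v w x y z : V) (t : R).

(** A finite intersection of neighbourhoods, for properties that depend on the
    radius monotonically. *)
Lemma common_bound (T : eqType) (r : seq T) (P : T -> R -> Prop) :
  (forall i d d', 0 < d' -> d' <= d -> P i d -> P i d') ->
  (forall i, i \in r -> exists2 d, 0 < d & P i d) ->
  exists2 d, 0 < d & forall i, i \in r -> P i d.
Proof.
move=> mono; elim: r => [_|i r IH h]; first by exists 1.
have [j jr|d d0 hd] := IH; first by apply: h; rewrite inE jr orbT.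
have [d' d'0 hd'] := h i (mem_head _ _).
have m0 : 0 < Num.min d d' by rewrite lt_min d0.
exists (Num.min d d') => // j; rewrite inE => /orP[/eqP->|jr].
  by apply: mono hd' => //; rewrite ge_min lexx orbT.
by apply: mono (hd j jr) => //; rewrite ge_min lexx.
Qed.
Definition close_seq (eps : R) s s' : Prop :=
  size s' = size s /\ forall i, close eps (nth 0 s' i) (nth 0 s i).

Definition nearby s (P : seq V -> Prop) : Prop :=
  exists2 eps, 0 < eps & forall s', close_seq eps s s' -> P s'.

Lemma close_le eps eps' p q : eps <= eps' -> close eps p q -> close eps' p q.
Proof. by move=> le h j; apply: lt_le_trans le. Qed.

Lemma close_seq_le eps eps' s s' :
  eps <= eps' -> close_seq eps s s' -> close_seq eps' s s'.
Proof. by move=> le [sz h]; split=> // i; apply: close_le le (h i). Qed.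

Lemma nearbyW s (P Q : seq V -> Prop) :
  (forall s', size s' = size s -> P s' -> Q s') -> nearby s P -> nearby s Q.
Proof. by move=> PQ [e e0 h]; exists e => // s' c; apply: PQ (h s' c); case: c. Qed.

Lemma nearby_all s n (P : nat -> seq V -> Prop) :
  (forall i, (i < n)%N -> nearby s (P i)) ->
  nearby s (fun s' => forall i, (i < n)%N -> P i s').
Proof.
move=> h; have [||e e0 he] := @common_bound _ (iota 0 n)
  (fun i e => forall s', close_seq e s s' -> P i s').
- by move=> i d d' _ le hd s' c; apply: hd; exact: close_seq_le c.
- by move=> i; rewrite mem_iota => /h.
by exists e => // s' c i lt; apply: he; rewrite ?mem_iota.
Qed.

Lemma nearby_and s (P Q : seq V -> Prop) : nearby s P -> nearby s Q ->
  nearby s (fun s' => P s' /\ Q s').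
Proof.
move=> hP hQ; have := @nearby_all s 2 (fun i => if i == 0%N then P else Q) _.
have h i : (i < 2)%N -> nearby s (if i == 0%N then P else Q) by case: i => [|[|]].
by move=> /(_ h); apply: nearbyW => s' _ h'; split; [exact: (h' 0%N)|exact: (h' 1%N)].
Qed.

Local Notation edge s i := (nth 0 s i, nth 0 s (i.+1 %% size s)).

Lemma stick_knot_nth s : stick_knot s <->
  [/\ (0 < size s)%N,
      forall i, (i < size s)%N -> nth 0 s i <> nth 0 s (i.+1 %% size s) &
      forall i j, (i < j)%N -> (j < size s)%N -> disj_edges (edge s i) (edge s j)].
Proof.
rewrite stick_knotE -size_eq0 -lt0n; split=> [[s0 sim]|[s0 nd dj]]; split=> //.
- move=> i ilt; move: (sim) => /andP[/(all_nthP (0, 0)) /(_ i)].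
  by rewrite size_edges nth_edges // => /(_ ilt) /eqP.
- move=> i j ij jlt; have ilt := ltn_trans ij jlt.
  rewrite -!nth_edges //; apply: simple_disj => //; rewrite ?size_edges //.
  by move=> e; rewrite e ltnn in ij.
apply/andP; split.
  by apply/(all_nthP (0, 0)) => i; rewrite size_edges => ilt; rewrite nth_edges //; apply/eqP/nd.
apply/(pairwiseP (0, 0)) => i j; rewrite !unfold_in size_edges => ilt jlt ij.
by apply/asboolP; rewrite !nth_edges //; exact: dj.
Qed.

Lemma close_comb (eps k t c c' : R) : 0 <= t -> t <= 1 -> `|k| < eps -> `|c| < eps ->
  c' = (1 - t) * k + t * c -> `|c'| < eps.
Proof.
move=> t0 t1; rewrite !ltr_norml => /andP[k0 k1] /andP[c0 c1] ->.
have p1 (x y : R) : x <= y -> 0 <= (1 - t) * (y - x) by move=> ?; rewrite mulr_ge0; lra.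
have p2 (x y : R) : x <= y -> 0 <= t * (y - x) by move=> ?; rewrite mulr_ge0; lra.
by have [kc|/ltW ck] := leP k c; apply/andP; split; [have := p2 _ _ kc|have := p1 _ _ kc|have := p1 _ _ ck|have := p2 _ _ ck]; lra.
Qed.

(** The missing final point of an edge starts the next edge, so two edges that
    are not consecutive are disjoint even when closed. *)
Lemma closed_edges_disj s i j z : stick_knot s -> (i < size s)%N -> (j < size s)%N ->
  i <> j -> (i.+1 %% size s)%N <> j -> (j.+1 %% size s)%N <> i ->
  segment (nth 0 s i) (nth 0 s (i.+1 %% size s)) z ->
  segment (nth 0 s j) (nth 0 s (j.+1 %% size s)) z -> False.
Proof.
move=> st ilt jlt ij i1j j1i.
have st0 : (0 < size s)%N by exact: leq_ltn_trans ilt.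
have /stick_knotE[_ sim] := st.
have dj (k l : nat) x : (k < size s)%N -> (l < size s)%N -> k <> l ->
    half_edge (edge s k) x -> half_edge (edge s l) x -> False.
  by move=> kl ll kl0; rewrite -!nth_edges //; apply: simple_disj; rewrite ?size_edges.
have strt k : (k < size s)%N -> half_edge (edge s (k %% size s)) (nth 0 s (k %% size s)).
  by move=> _; exact: (half_edge_start (_, _)).
move=> /segment_half[h1|z1] /segment_half[h2|z2].
- exact: dj h1 h2.
- apply: (dj _ (j.+1 %% size s)%N) h1 _ => //; rewrite ?ltn_pmod //; first by move/esym.
  by rewrite z2; exact: (half_edge_start (_, _)).
- apply: (dj (i.+1 %% size s)%N j z) _ h2 => //; rewrite ?ltn_pmod //.
  by rewrite z1; exact: (half_edge_start (_, _)).
have := stick_knot_uniq st => /(uniqP 0) inj.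
have : (i.+1 %% size s)%N = (j.+1 %% size s)%N.
  by apply: inj; [rewrite inE ltn_pmod|rewrite inE ltn_pmod|rewrite -z1 -z2].
move/eqP; rewrite -[i.+1]addn1 -[j.+1]addn1 eqn_modDr => /eqP.
by rewrite !modn_small.
Qed.

Lemma close_sub eps p q p' q' : close (eps / 2) p' p -> close (eps / 2) q' q ->
  close eps (p - q) (p' - q').
Proof.
move=> h1 h2 j; have := h1 j; have := h2 j; rewrite !mxE !ltr_norml.
by move=> /andP[? ?] /andP[? ?]; apply/andP; split; lra.
Qed.

Lemma near_disj_far s i j : stick_knot s -> (i < size s)%N -> (j < size s)%N ->
  i <> j -> (i.+1 %% size s)%N <> j -> (j.+1 %% size s)%N <> i ->
  nearby s (fun s' => disj_edges (edge s' i) (edge s' j)).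
Proof.
move=> st ilt jlt ij i1j j1i.
have [|eps eps0 h] := @gap R (nth 0 s i - nth 0 s j)
   (nth 0 s (i.+1 %% size s) - nth 0 s i) (nth 0 s j - nth 0 s (j.+1 %% size s)).
  move=> t u /andP[t0 t1] /andP[u0 u1] eq.
  apply: (closed_edges_disj (z := nth 0 s i + t *: (nth 0 s (i.+1 %% size s) - nth 0 s i)) st ilt jlt ij i1j j1i).
    by exists t; split=> //; apply/rowP=> k; rewrite !mxE; ring.
  exists u; split=> //; apply/rowP=> k; have := congr1 (fun v : V => v 0 k) eq.
  rewrite !mxE; lra.
exists (eps / 2); first exact: divr_gt0.
move=> s' [sz c] z [t /= [t0 t1 ->]] [u /= [u0 u1 eq]]; rewrite sz in eq.
apply: (h (nth 0 s' i - nth 0 s' j) (nth 0 s' (i.+1 %% size s) - nth 0 s' i)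
  (nth 0 s' j - nth 0 s' (j.+1 %% size s)) _ _ _ t u);
  rewrite ?t0 ?u0 ?ltW //; try exact: close_sub.
apply/rowP=> k; have := congr1 (fun v : V => v 0 k) eq.
rewrite !mxE; lra.
Qed.

(** Two consecutive sticks meet outside their common vertex, or one of them
    degenerates, exactly when some convex combination of their directions
    vanishes; the gap lemma applies to the segment of these combinations. *)
Lemma near_disj_next s i : let j := (i.+1 %% size s)%N in
  stick_knot s -> (i < size s)%N ->
  nearby s (fun s' => nth 0 s' i <> nth 0 s' j /\ disj_edges (edge s' i) (edge s' j)).
Proof.
move=> j st ilt; have jlt : (j < size s)%N by rewrite ltn_pmod // (leq_ltn_trans _ ilt).
have sz3 := stick_knot_size st.
have /stick_knotE[_ sim] := st.
have ij : i <> j.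
  rewrite /j; have [h|h|h] := ltngtP i.+1 (size s).
  - by rewrite modn_small //; lia.
  - by move: ilt; rewrite ltnNge -ltnS h.
  - by rewrite h modnn; lia.
have dj : disj_edges (edge s i) (edge s j).
  by rewrite -!nth_edges //; apply: simple_disj; rewrite ?size_edges.
have nd k : (k < size s)%N -> nth 0 s k <> nth 0 s (k.+1 %% size s).
  move=> klt; move: (sim) => /andP[/(all_nthP (0, 0)) /(_ k)].
  by rewrite size_edges nth_edges // => /(_ klt) /eqP.
set k := (j.+1 %% size s)%N in dj.
set A := nth 0 s j - nth 0 s i; set B := nth 0 s k - nth 0 s j.
have nf u : 0 <= u -> u <= 1 -> (1 - u) *: A + u *: B <> 0.
  move=> u0 u1 eq; have [u1'|u1'] := eqVneq u 1.
    move: eq; rewrite u1' subrr scale0r scale1r add0r => /eqP.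
    by rewrite subr_eq0 => /eqP/esym; exact: nd.
  have u1'' : u < 1 by rewrite lt_neqAle u1'.
  apply: (dj (nth 0 s j + (u / 2) *: B)).
    exists (1 - (1 - u) / 2); split; [lra|lra|] => /=.
    rewrite -/j; apply/rowP=> l; have := congr1 (fun v : V => v 0 l) eq.
    rewrite !mxE; lra.
  by exists (u / 2); split; [lra|lra|].
have [|eps eps0 h] := @gap R A (B - A) 0.
  move=> t u /andP[t0 t1] _ eq; apply: (nf t t0 t1).
  by rewrite -eq; apply/rowP => l; rewrite !mxE; ring.
exists (eps / 4); first exact: divr_gt0.
move=> s' [sz c].
have nf' u : 0 <= u -> u <= 1 ->
   (1 - u) *: (nth 0 s' j - nth 0 s' i) + u *: (nth 0 s' k - nth 0 s' j) <> 0.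
  move=> u0 u1 eq.
  apply: (h (nth 0 s' j - nth 0 s' i) (nth 0 s' k - nth 0 s' j - (nth 0 s' j - nth 0 s' i)) 0 _ _ _ u 0).
  - apply: close_sub; apply: close_le (c _); lra.
  - have hB : close (eps / 2) (nth 0 s' k - nth 0 s' j) B.
      move=> l; rewrite distrC; apply: (@close_sub (eps / 2)); apply: close_le (c _); lra.
    have hA : close (eps / 2) (nth 0 s' j - nth 0 s' i) A.
      move=> l; rewrite distrC; apply: (@close_sub (eps / 2)); apply: close_le (c _); lra.
    exact: close_sub.
  - by move=> l; rewrite subrr normr0.
  - by rewrite u0.
  - by rewrite lexx ler01.
  - by rewrite -[RHS]eq; apply/rowP => l; rewrite !mxE; ring.
split.
  move=> e; apply: (nf' 0) => //; rewrite scale0r addr0 e subrr scaler0 //.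
rewrite sz -/j -/k => z [t /= [t0 t1 ->]] [u /= [u0 u1 eq]].
have pos : 0 < (1 - t) + u by lra.
apply: (nf' (u / ((1 - t) + u))).
- by rewrite divr_ge0 // ltW.
- by rewrite ler_pdivrMr // mul1r; lra.
apply/rowP => l; have := congr1 (fun v : V => v 0 l) eq; rewrite !mxE => eql.
have -> : (1 - u / (1 - t + u)) * (nth 0 s' j 0 l - nth 0 s' i 0 l) +
  u / (1 - t + u) * (nth 0 s' k 0 l - nth 0 s' j 0 l) =
  ((1 - t) * (nth 0 s' j 0 l - nth 0 s' i 0 l) +
   u * (nth 0 s' k 0 l - nth 0 s' j 0 l)) / (1 - t + u).
  by field; rewrite gt_eqF.
by rewrite (_ : _ + _ = 0) ?mul0r //; lra.
Qed.

(** Embeddedness is a finite conjunction of open conditions, one for each pair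
    of edges. *)
Lemma near_stick s : stick_knot s -> nearby s stick_knot.
Proof.
move=> st; have sz3 := stick_knot_size st.
have next i (ilt : (i < size s)%N) := near_disj_next st ilt.
have nx : nearby s (fun s' => forall i, (i < size s)%N ->
    nth 0 s' i <> nth 0 s' (i.+1 %% size s) /\
    disj_edges (edge s' i) (edge s' (i.+1 %% size s))) by exact: nearby_all.
have dd : nearby s (fun s' => forall i, (i < size s)%N -> forall j, (j < size s)%N ->
    (i < j)%N -> disj_edges (edge s' i) (edge s' j)).
  apply: nearby_all => i ilt; apply: nearby_all => j jlt.
  have [ij|ij] := boolP (i < j)%N; last by exists 1.
  suff : nearby s (fun s' => disj_edges (edge s' i) (edge s' j)).
    by apply: nearbyW.
  have [e1|e1] := eqVneq (i.+1 %% size s)%N j.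
    by have := next i ilt; rewrite e1; apply: nearbyW => s' _ [].
  have [e2|e2] := eqVneq (j.+1 %% size s)%N i.
    have := next j jlt; rewrite e2; apply: nearbyW => s' _ [_ h] p h1 h2.
    exact: h h2 h1.
  apply: near_disj_far => //; try exact/eqP.
  by move=> eij; rewrite eij ltnn in ij.
apply: nearbyW (nearby_and nx dd) => s' sz [h1 h2]; apply/stick_knot_nth.
rewrite sz; split=> [|i ilt|i j ij jlt]; first by lia.
  by case: (h1 i ilt).
by have := h2 i (ltn_trans ij jlt) j jlt ij; rewrite sz.
Qed.

(** The vertices move one at a time.  In a ball in which every polygon is
    embedded, the move of a vertex from v to w passes through a generic point
    p, off a plane through the neighbours and v and off one through the
    neighbours and w, so that the two halves of the move are of the kind
    treated above. *)
Lemma knot_stable s : stick_knot s ->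
  nearby s (fun s' => stick_knot s' /\ knot_equiv s s').
Proof.
move=> st; have sz3 := stick_knot_size st.
have [eps eps0 h] := near_stick st.
exists eps => // s' cs'; split; first exact: h.
have [sz c] := cs'.
suff hyb k : (k <= size s)%N -> knot_equiv s (take k s' ++ drop k s).
  have := hyb (size s) (leqnn _).
  by rewrite -{1}sz take_size drop_size cats0.
elim: k => [_|k IH klt]; first by rewrite take0 drop0; exact: KnotRefl.
apply: (KnotTrans (IH (ltnW klt))).
have ks' : (k < size s')%N by rewrite sz.
rewrite (take_nth 0 ks') (drop_nth 0 klt) cat_rcons.
set T := take k s'; set D := drop k.+1 s.
set v := nth 0 s k; set w := nth 0 s' k.
have szT : size T = k by rewrite size_takel // ltnW.
have szD : (size T + (size D).+1 = size s)%N by rewrite szT size_drop; lia.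
have ball p : close eps p v -> stick_knot (T ++ p :: D).
  move=> pv; apply: h; split; first by rewrite size_cat.
  move=> i j; rewrite nth_cat szT.
  have [ik|ki] := ltnP i k; first by rewrite nth_take //; exact: c.
  case: (ltngtP i k) ki => // [ki _|-> _]; last by rewrite subnn; exact: pv.
  have -> : (i - k = (i - k.+1).+1)%N by lia.
  by rewrite /= nth_drop subnKC // subrr normr0.
have : exists b l, D ++ T = b :: l /\ l != [::].
  case E : (D ++ T) => [|b [|b' l]]; last by exists b, (b' :: l).
    by move: (congr1 size E); rewrite size_cat /=; lia.
  by move: (congr1 size E); rewrite size_cat /=; lia.
move=> [b [l [DT l0]]].
have rotp p : rot k (T ++ p :: D) = p :: b :: l.
  by rewrite /rot -szT drop_size_cat // take_size_cat //= DT.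
have ballr p : close eps p v -> stick_knot (p :: b :: l).
  by move=> /ball /(stick_knot_rot k); rewrite rotp.
pose a := last b l.
have [g1 g10 [g1a g1b]] := annihilator (a - v) (b - v).
have [g2 g20 [g2a g2b]] := annihilator (a - w) (b - w).
pose g (i : bool) := if i then g1 else g2.
pose kk (i : bool) := - lf (g i) (if i then v else w).
have [|p pv pg] := @avoid_planes R _ predT g kk v eps _ eps0.
  by move=> [_|_]; left.
have vv : close eps v v by move=> j; rewrite subrr normr0.
have wv : close eps w v by exact: c.
have mid x t : close eps x v -> 0 <= t -> t <= 1 -> close eps (x + t *: (p - x)) v.
  move=> xv t0 t1 j; apply: (close_comb t0 t1 (xv j) (pv j)).
  by rewrite !mxE; ring.
have move1 x gx : close eps x v -> lf gx (a - x) = 0 -> lf gx (b - x) = 0 ->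
    lf gx p - lf gx x != 0 -> knot_equiv (x :: b :: l) (p :: b :: l).
  move=> xv ga gb gpx; apply: (@vertex_move R x p b l gx) => //.
  - by move=> t t0 t1; apply: ballr; exact: mid.
  - by apply/eqP; rewrite -subr_eq0 -lfB gb.
  - by apply/eqP; rewrite -subr_eq0 -lfB ga.
  - by apply/eqP; rewrite -subr_eq0.
have mv : knot_equiv (v :: b :: l) (w :: b :: l).
  apply: (@KnotTrans _ _ (p :: b :: l)).
    exact: (move1 _ g1) vv g1a g1b (pg true isT).
  apply: KnotSym; exact: (move1 _ g2) wv g2a g2b (pg false isT).
apply: (KnotTrans (KnotRot k _)); rewrite rotp; apply: (KnotTrans mv).
by rewrite -(rotp w); apply: KnotSym; exact: KnotRot.
Qed.

End Stability.

(** * Isotopies and projective maps *)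

Section Isotopy.
Context {R : realType}.
Local Notation V := 'rV[R]_3.
Implicit Types (s l : seq V) (a b p q u v w x y z : V) (t : R).

(** By stability the class is locally constant along the path; the supremum of
    the times up to which it agrees with the initial class must be 1. *)
Lemma isotopy (S : R -> seq V) :
  (forall t, 0 <= t <= 1 -> stick_knot (S t)) ->
  (forall t eps, 0 <= t <= 1 -> 0 < eps -> exists2 d, 0 < d &
     forall t', 0 <= t' <= 1 -> `|t' - t| < d -> close_seq eps (S t) (S t')) ->
  knot_equiv (S 0) (S 1).
Proof.
move=> st ct.
have loc t : 0 <= t <= 1 -> exists2 d, 0 < d &
    forall t', 0 <= t' <= 1 -> `|t' - t| < d -> knot_equiv (S t) (S t').
  move=> t01; have [eps eps0 h] := knot_stable (st t t01).
  have [d d0 hd] := ct t eps t01 eps0; exists d => // t' t'01 tt.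
  by have [] := h _ (hd t' t'01 tt).
pose E : set R := [set t | 0 <= t <= 1 /\ knot_equiv (S 0) (S t)].
have E0 : E 0 by split; [rewrite lexx ler01|exact: KnotRefl].
have Eub : ubound E 1 by move=> t [/andP[]].
have sE : has_sup E by split; [exists 0|exists 1].
have c0 : 0 <= sup E by apply: sup_ubound; [exact: (proj2 sE)|].
have c1 : sup E <= 1 by apply: ge_sup; [exists 0|].
have [|d d0 hd] := loc (sup E); first by rewrite c0.
have [t [/andP[t0 t1] Et] td] := sup_adherent d0 sE.
have tc : t <= sup E by apply: sup_ubound; [exact: (proj2 sE)|split=> //; rewrite t0].
have ESup : knot_equiv (S 0) (S (sup E)).
  apply: (KnotTrans Et); apply: KnotSym; apply: hd; first by rewrite t0.
  by rewrite ler0_norm; lra.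
have [lt1|] := ltP (sup E) 1; last first.
  by move=> ge; have <- : sup E = 1 by apply/eqP; rewrite eq_le c1.
pose t' := Num.min 1 (sup E + d / 2).
have t'c : sup E < t' by rewrite lt_min lt1 /=; lra.
have t'1 : t' <= 1 by rewrite ge_min lexx.
have t'd : t' <= sup E + d / 2 by rewrite ge_min lexx orbT.
have Et' : E t'.
  split; first by apply/andP; split => //; lra.
  apply: (KnotTrans ESup); apply: hd; first by apply/andP; split => //; lra.
  by rewrite gtr0_norm; lra.
suff : t' <= sup E by lra.
by apply: sup_ubound => //; exact: (proj2 sE).
Qed.

Lemma edges_map (f : V -> V) s :
  edges (map f s) = [seq (f e.1, f e.2) | e <- edges s].
Proof.
case: s => //= x l; rewrite -map_rcons; move: (rcons l x) => l'.
by elim: l' x => //= y l' IH x; rewrite IH.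
Qed.

(** The form in which a projective map preserves edges: it need not preserve
    the parameter along an edge, only the edge as a set. *)
Definition maps_edges (C : V -> Prop) (f : V -> V) :=
  forall a b z, C a -> C b -> half_edge (f a, f b) z ->
    exists p, [/\ C p, half_edge (a, b) p & z = f p].

Lemma mem_edges s e : e \in edges s -> e.1 \in s /\ e.2 \in s.
Proof.
move=> /(nthP (0, 0)) [i]; rewrite size_edges => ilt.
by rewrite nth_edges // => <- /=; rewrite !mem_nth // ltn_pmod // (leq_ltn_trans _ ilt).
Qed.

Lemma stick_knot_map (C : V -> Prop) (f : V -> V) s :
  (forall x y, C x -> C y -> f x = f y -> x = y) -> maps_edges C f ->
  (forall x, x \in s -> C x) -> stick_knot s -> stick_knot (map f s).
Proof.
move=> inj me Cs; rewrite !stick_knotE edges_map => -[s0 /andP[nd pw]].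
split; first by case: (s) s0.
apply/andP; split.
  rewrite all_map; apply/allP => e ein /=; have [e1 e2] := mem_edges ein.
  by move: nd => /allP/(_ e ein); apply: contraNneq => /inj -> //; exact: Cs.
apply/(pairwiseP (0, 0)) => i j; rewrite !unfold_in size_map => ilt jlt ij.
rewrite !(nth_map (0, 0)) //; apply/asboolP => z.
have [i1 i2] := mem_edges (mem_nth (0, 0) ilt).
have [j1 j2] := mem_edges (mem_nth (0, 0) jlt).
move=> /me[||p [Cp pe ->]]; [exact: Cs|exact: Cs|].
move=> /me[||q [Cq qe]]; [exact: Cs|exact: Cs|].
move=> /inj pq; rewrite pq // in pe.
have /asboolP h := elimT (pairwiseP (0, 0)) pw i j ilt jlt ij.
apply: (h q); [move: pe|move: qe]; by rewrite -surjective_pairing.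
Qed.

(** The projective map with matrix I + U G, for G = (g, k) a linear form and
    U = (u, c) a vector in homogeneous coordinates. *)
Definition transvection (g : 'cV[R]_3) (k : R) u (c : R) x : V :=
  (1 + c * (lf g x + k))^-1 *: (x + (lf g x + k) *: u).

Section Transvection.
Variables (g : 'cV[R]_3) (k : R) (u : V) (c : R).
Local Notation G x := (lf g x + k).
Local Notation T := (transvection g k u c).
Let C x := 0 < 1 + c * G x.

(** The assumption says that the determinant 1 + G U of I + U G is positive.
    Two points with the same image have proportional images in homogeneous
    coordinates, and the determinant allows to cancel I + U G. *)
Lemma transvection_inj : 0 < 1 + (lf g u + c * k) ->
  forall x y, C x -> C y -> T x = T y -> x = y.
Proof.
rewrite /C => pos x y Cx Cy eq.
pose m := (1 + c * G x) / (1 + c * G y).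
have eqv : x + G x *: u = m *: (y + G y *: u).
  have := congr1 (fun v => (1 + c * G x) *: v) eq.
  by rewrite /T /transvection !scalerA mulfV ?scale1r ?gt_eqF.
have eqd : 1 + c * G x = m * (1 + c * G y) by rewrite /m divfK // gt_eqF.
have eqg : G x = m * G y.
  have := congr1 (lf g) eqv; rewrite !lfE => h.
  apply: (mulIf (lt0r_neq0 pos)); move: eqd => /(congr1 (fun t => k * t)); nra.
have m1 : m = 1 by rewrite eqg in eqd; lra.
move: eqv; rewrite eqg m1 mul1r scale1r => /addIr //.
Qed.

Lemma transvection_edges : maps_edges C T.
Proof.
move=> a b z; rewrite /C => Ca Cb [m /= [m0 m1 ->]].
set Da := 1 + c * G a in Ca; set Db := 1 + c * G b in Cb.
have W0 : 0 < (1 - m) * Db + m * Da.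
  by apply: ltr_wpDr; [rewrite mulr_ge0 // ltW|rewrite mulr_gt0 //; lra].
(* The barycentric weights are rescaled by the denominators at a and b. *)
pose t := m * Da / ((1 - m) * Db + m * Da).
have Gp : G (a + t *: (b - a)) = G a + t * (G b - G a) by rewrite !lfE; ring.
have Dp : 1 + c * G (a + t *: (b - a)) = Da * Db / ((1 - m) * Db + m * Da).
  have -> : 1 + c * G (a + t *: (b - a)) = Da + t * (Db - Da).
    by rewrite Gp /Da /Db; ring.
  by rewrite /t; field; rewrite gt_eqF.
exists (a + t *: (b - a)); split.
- by rewrite Dp divr_gt0 // mulr_gt0.
- exists t; split=> //=.
    by rewrite /t; apply: divr_ge0; [apply: mulr_ge0 => //|]; exact: ltW.
  by rewrite /t ltr_pdivrMr // mul1r ltrDr mulr_gt0 //; lra.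
rewrite /transvection Dp Gp -/Da -/Db; apply/rowP=> i; rewrite !mxE /t.
by field; rewrite !gt_eqF.
Qed.

End Transvection.

Lemma close_seq_map eps (f f' : V -> V) s : 0 < eps ->
  (forall x, x \in s -> close eps (f' x) (f x)) ->
  close_seq eps (map f s) (map f' s).
Proof.
move=> eps0 h; split; first by rewrite !size_map.
move=> i; have [ilt|ige] := ltnP i (size s).
  by rewrite !(nth_map 0) //; apply: h; rewrite mem_nth.
by move=> j; rewrite !nth_default ?size_map // subrr normr0.
Qed.

Lemma transvection0 u c x : transvection 0 0 u c x = x.
Proof. by rewrite /transvection /lf mulmx0 mxE addr0 mulr0 addr0 invr1 !scale1r scale0r addr0. Qed.

(** Multiplying G by t, for t from 0 to 1, joins the identity to the given map
    by maps of the same kind, whose denominators and determinant stay positive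
    because they are convex combinations of 1 and the final values.  Hence the
    images of the knot form an isotopy. *)
Lemma knot_transvection (g : 'cV[R]_3) (k : R) u (c : R) s :
  stick_knot s -> (forall x, x \in s -> 0 < 1 + c * (lf g x + k)) ->
  0 < 1 + (lf g u + c * k) ->
  stick_knot (map (transvection g k u c) s) /\
  knot_equiv s (map (transvection g k u c) s).
Proof.
move=> st Cs pos.
have lfsc t x : lf (t *: g) x = t * lf g x by rewrite /lf -scalemxAr mxE.
have lfs t x : lf (t *: g) x + t * k = t * (lf g x + k).
  by rewrite lfsc; ring.
have conv (t d : R) : 0 <= t <= 1 -> 0 < 1 + d -> Num.min 1 (1 + d) <= 1 + t * d.
  move=> /andP[t0 t1] d1; have [h|h] := leP 1 (1 + d); nra.
have stt t : 0 <= t <= 1 -> stick_knot (map (transvection (t *: g) (t * k) u c) s).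
  move=> t01; apply: (stick_knot_map _ (@transvection_edges _ _ _ _)) st.
    apply: transvection_inj.
    have := conv t _ t01 pos; have : 0 < Num.min 1 (1 + (lf g u + c * k)).
      by rewrite lt_min ltr01.
    by rewrite lfsc; lra.
  move=> x xs; rewrite lfs mulrCA.
  have := conv t _ t01 (Cs x xs); have : 0 < Num.min 1 (1 + c * (lf g x + k)).
    by rewrite lt_min ltr01 Cs.
  lra.
have end1 : map (transvection (1 *: g) (1 * k) u c) s = map (transvection g k u c) s.
  by rewrite scale1r mul1r.
have end0 : map (transvection (0 *: g) (0 * k) u c) s = s.
  rewrite scale0r mul0r -[RHS]map_id; apply: eq_map => x; exact: transvection0.
split; first by rewrite -end1; apply: stt; rewrite ler01 lexx.
rewrite -{1}end0 -end1; apply: (isotopy (S := fun t => map (transvection (t *: g) (t * k) u c) s)) => //.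
move=> t eps t01 eps0.
pose P (xj : V * 'I_3) d := forall t', 0 <= t' <= 1 -> `|t' - t| < d ->
  `|transvection (t' *: g) (t' * k) u c xj.1 0 xj.2 -
    transvection (t *: g) (t * k) u c xj.1 0 xj.2| < eps.
have [||d d0 hd] := @common_bound R _ [seq (x, j) | x <- s, j <- enum 'I_3] P.
- by move=> xj d d' _ le h t' t'01 lt; apply: h => //; apply: lt_le_trans le.
- move=> _ /allpairsP[[x j] [/= xs _ ->]].
  set al := (lf g x + k) * u 0 j; set be := c * (lf g x + k).
  pose mu := Num.min 1 (1 + be).
  have mu0 : 0 < mu by rewrite lt_min ltr01 Cs.
  pose K := `|al - be * x 0 j| + 1.
  have K0 : 0 < K by rewrite ltr_wpDl.
  exists (eps * mu ^+ 2 / K); first by rewrite divr_gt0 // mulr_gt0 // exprn_gt0.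
  move=> t' t'01 lt /=.
  have TE t1 : transvection (t1 *: g) (t1 * k) u c x 0 j =
      (x 0 j + t1 * al) / (1 + t1 * be).
    by rewrite /transvection !lfs !mxE /al /be mulrCA mulrC -!mulrA.
  have D1 := conv t _ t01 (Cs x xs); have D2 := conv t' _ t'01 (Cs x xs).
  rewrite -/be -/mu in D1 D2.
  have D1' := lt_le_trans mu0 D1; have D2' := lt_le_trans mu0 D2.
  rewrite !TE.
  have -> : (x 0 j + t' * al) / (1 + t' * be) - (x 0 j + t * al) / (1 + t * be) =
     (t' - t) * (al - be * x 0 j) / ((1 + t' * be) * (1 + t * be)).
    by field; rewrite !gt_eqF.
  rewrite normrM normfV (gtr0_norm (mulr_gt0 D2' D1')) ltr_pdivrMr ?mulr_gt0 //.
  apply: (@lt_le_trans _ _ (eps * mu ^+ 2)); last first.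
    by rewrite ler_pM2l // expr2 ler_pM // ltW.
  rewrite normrM; apply: (@le_lt_trans _ _ (`|t' - t| * K)).
    by rewrite ler_wpM2l // /K lerDl.
  by move: lt; rewrite ltr_pdivlMr.
exists d => // t' t'01 lt; apply: close_seq_map => // x xs j.
by apply: (hd (x, j)) => //; apply/allpairsP; exists (x, j); rewrite mem_enum.
Qed.

End Isotopy.

(** * Perspectivities and curtains *)

Section Cone.
Context {R : realType}.
Local Notation V := 'rV[R]_3.
Implicit Types (s l : seq V) (a b p q u v w z : V) (x y : nat * R).

(** Independence of a and b modulo d, that is, of their projections along d. *)
Definition indep_mod (d a b : V) : Prop :=
  forall k m t : R, k *: a + m *: b = t *: d -> k = 0 /\ m = 0.

(** The condition on double points of a regular projection, expressed by
    vertical lines instead of an orthogonal projection, which makes it affinely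
    invariant. *)
Definition regular_along d s : Prop := forall x y, closed_param s x -> closed_param s y ->
  x <> y -> forall t, poly_pt s x - poly_pt s y = t *: d ->
  [/\ 0 < x.2, 0 < y.2 & indep_mod d (edge_dir s x.1) (edge_dir s y.1)].

Definition runs_under d (A B : seq V) : Prop := forall x y,
  closed_param (A ++ B) x -> closed_param (A ++ B) y ->
  (x.1 < y.1)%N -> ((size A).-1 <= y.1)%N ->
  forall t, poly_pt (A ++ B) x - poly_pt (A ++ B) y = t *: d -> 0 < t.

(** The perspectivity p / (1 + g p): it sends the point at infinity of a
    direction d with g d <> 0 to d / (g d), the apex of all images of lines
    parallel to d. *)
Definition persp (g : 'cV[R]_3) : V -> V := transvection g 0 0 1.

Section Perspective.
Variables (g : 'cV[R]_3) (d : V).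
Hypothesis gd : lf g d < 0.
Let P := (lf g d)^-1 *: d.
Let C p := 0 < 1 + 1 * (lf g p + 0).
Local Notation T := (persp g).

Lemma persp_inj p q : C p -> C q -> T p = T q -> p = q.
Proof. by apply: transvection_inj; rewrite /lf mul0mx mxE mulr0 !addr0. Qed.

Lemma persp_edges : maps_edges C T.
Proof. exact: transvection_edges. Qed.

Lemma perspE p : T p = (1 + lf g p)^-1 *: p.
Proof. by rewrite /persp /transvection scaler0 !addr0 mul1r. Qed.

Lemma persp_neq_apex p : C p -> T p <> P.
Proof.
rewrite /C mul1r addr0 => Cp; rewrite perspE => /(congr1 (lf g)).
rewrite /P !lfZ mulVf ?lt_eqF // => h.
have := congr1 (fun t => (1 + lf g p) * t) h; rewrite mulVKf ?gt_eqF // mulr1; lra.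
Qed.

(** The images of the lines in direction d pass through the apex, and the ray
    from p in direction -d fills the part of its image line between T p and the
    apex. *)
Lemma persp_ray p z : C p -> half_edge (T p, P) z ->
  exists t, [/\ 0 <= t, C (p - t *: d) & z = T (p - t *: d)].
Proof.
rewrite /C mul1r addr0 => Cp [m /= [m0 m1 ->]].
have m1' : 0 < 1 - m by lra.
pose t := (1 + lf g p) * m / ((1 - m) * - lf g d).
have t0 : 0 <= t.
  apply: divr_ge0; apply: mulr_ge0; rewrite ?oppr_ge0 //; exact: ltW.
exists t; split=> //.
  rewrite mul1r addr0 !lfE; have : t * lf g d <= 0 by rewrite mulr_ge0_le0 // ltW.
  by lra.
have gd0 := lt_eqF gd.
have -> : T (p - t *: d) = ((1 + lf g p) / (1 - m))^-1 *: (p - t *: d).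
  rewrite perspE; congr (_^-1 *: _); rewrite !lfE /t; field.
  by rewrite gd0 gt_eqF.
rewrite perspE /P /t; apply/rowP => i; rewrite !mxE; field.
by rewrite gd0 !gt_eqF.
Qed.

Lemma persp_ray_rev p z : C p -> half_edge (P, T p) z -> z = P \/
  exists t, [/\ 0 < t, C (p - t *: d) & z = T (p - t *: d)].
Proof.
move=> Cp [m /= [m0 m1 zE]]; have [m00|m00] := eqVneq m 0.
  by left; rewrite zE m00 scale0r addr0.
have mp : 0 < m by rewrite lt_neqAle eq_sym m00.
right; have [|t [t0 Ct zt]] := @persp_ray p z Cp.
  exists (1 - m); split => /=; [lra|lra|].
  by rewrite zE; apply/rowP => i; rewrite !mxE; ring.
exists t; split=> //; rewrite lt_neqAle t0 andbT; apply/eqP => t00.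
apply: (persp_neq_apex Cp); apply/eqP; rewrite -subr_eq0.
have : (1 - m) *: (T p - P) = 0.
  rewrite scalerBl scale1r; move: zt; rewrite -t00 scale0r subr0 zE => e.
  by rewrite -{1}e addrAC addrK subrr.
by move=> /eqP; rewrite scaler_eq0 => /orP[/eqP|//]; lra.
Qed.

(** A triangle at the apex is the image of a curtain, the union of the rays in
    direction -d that start on a segment. *)
Lemma persp_curtain p q z : C p -> C q -> triangle (T p) (T q) P z -> z = P \/
  exists p' t, [/\ segment p q p', segment (T p) (T q) (T p'), 0 <= t,
    C p' /\ C (p' - t *: d) & z = T (p' - t *: d)].
Proof.
move=> Cp Cq [t [u [k [[t0 u0 k0] tuk zE]]]].
have [tu0|tu0] := eqVneq (t + u) 0.
  have [t00 u00 k1] : [/\ t = 0, u = 0 & k = 1] by split; lra.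
  by left; rewrite zE t00 u00 k1 !scale0r !add0r scale1r.
right; have tup : 0 < t + u by rewrite lt_neqAle eq_sym tu0; lra.
pose y := T p + (u / (t + u)) *: (T q - T p).
have ys : segment (T p) (T q) y.
  exists (u / (t + u)); split.
  - by rewrite divr_ge0 // ltW.
  - by rewrite ler_pdivrMr // mul1r; lra.
  - by rewrite /y; apply/rowP=> i; rewrite !mxE; ring.
have [p' [Cp' p's yp']] : exists p', [/\ C p', segment p q p' & y = T p'].
  case/segment_half: (ys) => [/persp_edges[||p' [Cp' h ->]] //|->].
    by exists p'; split=> //; exact: half_segment.
  exists q; split=> //; exists 1; split=> //; rewrite ?ler01 //.
  by rewrite subrr scale0r scale1r add0r.
have zy : half_edge (y, P) z.
  exists k; split=> //=; first lra.
  rewrite zE /y (_ : k = 1 - (t + u)); last lra.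
  by move: (T p) (T q) P => a b c; apply/rowP=> i; rewrite !mxE; field.
rewrite yp' in ys zy; have [t' [t'0 Ct' ->]] := persp_ray Cp' zy.
by exists p', t'.
Qed.

End Perspective.
End Cone.

(** * The cone over a rail arc *)

Section ConeMoves.
Context {R : realType}.
Local Notation V := 'rV[R]_3.
Implicit Types (s l : seq V) (a b p q u v w z : V) (x y : nat * R).

Lemma path_edges_map (f : V -> V) h l :
  path_edges (f h) (map f l) = [seq (f e.1, f e.2) | e <- path_edges h l].
Proof. by elim: l h => //= y l IH h; rewrite IH. Qed.

Lemma path_edges_point h r k e z : (k <= size r)%N ->
  e \in path_edges h (take k r) -> half_edge e z ->
  exists y, [/\ closed_param (h :: r) y, (y.1 < k)%N & z = poly_pt (h :: r) y].
Proof.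
move=> kr /(nthP (0, 0)) [i]; rewrite size_path_edges size_takel // => ik <-.
move=> [t [t0 t1 ->]]; have ir := leq_trans ik kr.
exists (i, t); split=> //; first by split=> /=; [exact: ltnW|rewrite t0].
have -> : nth (0, 0) (path_edges h (take k r)) i = nth (0, 0) (edges (h :: r)) i.
  rewrite /= -{2}(cat_take_drop k r) rcons_cat path_edges_cat nth_cat.
  by rewrite size_path_edges size_takel // ik.
by rewrite poly_pt_edge //=; exact: ltnW.
Qed.

Section Moves.
Variables (g : 'cV[R]_3) (d h : V) (r : seq V) (n : nat).
Hypothesis gd : lf g d < 0.
Local Notation P := ((lf g d)^-1 *: d).
Local Notation T := (persp g).
Local Notation s := (h :: r).
Hypothesis n0 : (0 < n)%N.
Hypothesis nr : (n <= size r)%N.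
Hypothesis st : stick_knot s.
Hypothesis reg : regular_along d s.
Hypothesis under : forall x y, closed_param s x -> closed_param s y ->
  (x.1 < y.1)%N -> (n <= y.1)%N ->
  forall t, poly_pt s x - poly_pt s y = t *: d -> 0 < t.
Hypothesis pos : forall p, p \in s -> 0 < 1 + lf g p.

Let C p := 0 < 1 + 1 * (lf g p + 0).

Let dn0 : d != 0.
Proof. by apply: contraTneq gd => ->; rewrite /lf mul0mx mxE ltxx. Qed.

Let posC p : p \in s -> C p.
Proof. by rewrite /C mul1r addr0; exact: pos. Qed.

Let Ch : C h.
Proof. by apply: posC; rewrite mem_head. Qed.

Let nth_s k : (k <= size r)%N -> C (nth 0 s k).
Proof. by move=> kr; apply: posC; rewrite mem_nth. Qed.

Let vertexE k : poly_pt s (k, 0) = nth 0 s k.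
Proof. by rewrite /poly_pt scale0r addr0. Qed.

Let vertex_param k : (k <= size r)%N -> closed_param s (k, 0).
Proof. by move=> kr; split=> //=; rewrite lexx ltr01. Qed.

(* Regularity forbids double points at vertices. *)
Let no_vertical k y t : (k <= size r)%N -> closed_param s y -> (k, 0) <> y ->
  nth 0 s k - poly_pt s y = t *: d -> False.
Proof.
move=> kr cy ky; rewrite -vertexE => e.
by have [] := reg (vertex_param kr) cy ky e; rewrite ltxx.
Qed.

Let path_point k e z : (k <= size r)%N ->
  e \in path_edges (T h) (map T (take k r)) -> half_edge e z ->
  exists y, [/\ closed_param s y, (y.1 < k)%N, C (poly_pt s y) & z = T (poly_pt s y)].
Proof.
move=> kr; rewrite path_edges_map => /mapP[e' e'in ->].
have Ce : C e'.1 /\ C e'.2.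
  move: e'in => /(nthP (0, 0)) [i]; rewrite size_path_edges size_takel // => ik <-.
  rewrite nth_path_edges ?size_takel //=; have ir := leq_trans ik kr.
  rewrite nth_take //; split; last by apply: (nth_s ir).
  by case: (i) ik ir => //= j jk jr; rewrite nth_take ?(ltnW jk) //; apply: (nth_s (ltnW jr)).
move=> /(persp_edges Ce.1 Ce.2)[p [Cp pe ->]].
have [|y [cy yk py]] := path_edges_point kr e'in (z := p).
  by rewrite [e']surjective_pairing.
by exists y; rewrite -py.
Qed.

Let cone k := P :: map T (h :: take k r).

Let last_cone k : (k <= size r)%N -> last (T h) (map T (take k r)) = T (nth 0 s k).
Proof.
move=> kr; rewrite last_map; congr T; rewrite (last_nth 0) size_takel //.
by case: k kr => //= k kr; rewrite nth_take.
Qed.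

Let st_T : stick_knot (map T s) /\ knot_equiv s (map T s).
Proof.
apply: knot_transvection => //.
by rewrite /lf mul0mx mxE mulr0 !addr0.
Qed.

Let sub_eq p q t t' : p - t *: d = q - t' *: d -> p - q = (t - t') *: d.
Proof.
move=> e; have -> : p = q - t' *: d + t *: d by rewrite -e subrK.
by rewrite scalerBl; apply/rowP=> i; rewrite !mxE; ring.
Qed.

(* The edges at the apex are images of the rays hanging from the two ends of
   the path.  These are vertices of s, so their vertical lines meet s nowhere
   else. *)
Let cone_stick k : (n <= k)%N -> (k <= size r)%N -> stick_knot (cone k).
Proof.
move=> nk kr; have k0 := leq_trans n0 nk.
apply/stick_cone; rewrite last_cone //; split.
- by move/esym; exact: persp_neq_apex.
- by apply: persp_neq_apex => //; exact: nth_s.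
- have [/stick_knotE[_]] := st_T; rewrite /= -map_rcons -{1}(cat_take_drop k r).
  by rewrite rcons_cat map_cat path_edges_cat simple_cat => /andP[].
- move=> z /(persp_ray_rev gd Ch)[->|[t [t0 Ct ->]]].
    move=> /(persp_ray gd (nth_s kr))[t [t0 Ct e]].
    by apply: (persp_neq_apex gd Ct); rewrite -e.
  move=> /(persp_ray gd (nth_s kr))[t' [t'0 Ct' /persp_inj]].
  move=> /(_ Ct Ct')/sub_eq; rewrite -[h]/(nth 0 s 0) -(vertexE k).
  apply: no_vertical => //; first exact: vertex_param.
  by move=> [k00]; move: k0; rewrite -k00.
move=> e ein; split=> z.
  move=> /(persp_ray_rev gd Ch)[->|[t [t0 Ct ->]]].
    move=> /(path_point kr ein)[y [_ _ Cy e']].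
    by apply: (persp_neq_apex gd Cy); rewrite -e'.
  move=> /(path_point kr ein)[y [cy _ Cy /persp_inj]] => /(_ Ct Cy) e'.
  have e'' : h - poly_pt s y = t *: d by rewrite -e' opprB addrC subrK.
  have [y00|y0] := pselect ((0%N, 0) = y).
    move: e''; rewrite -y00 vertexE subrr => /esym/eqP.
    by rewrite scaler_eq0 (negPf dn0) orbF gt_eqF.
  by apply: (no_vertical (k := 0) _ cy y0 e'').
move=> /(path_point kr ein)[y [cy yk Cy ->]].
move=> /(persp_ray gd (nth_s kr))[t [t0 Ct /persp_inj]] => /(_ Cy Ct) e'.
apply: (no_vertical kr cy (t := t)); last by rewrite e' opprB addrC subrK.
by move=> e''; move: yk; rewrite -e'' ltnn.
Qed.

(* One more vertex of the lower arc is inserted before the apex.  The triangle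
   swept is the image of the curtain hanging from one edge of the lower arc,
   and every earlier strand passes above that edge. *)
Let cone_step k : (n <= k)%N -> (k < size r)%N -> knot_equiv (cone k) (cone k.+1).
Proof.
move=> nk kr; have k0 := leq_trans n0 nk.
pose c := nth 0 r k.
have coneS : cone k.+1 = rcons (cone k) (T c).
  by rewrite /cone (take_nth 0 kr) -rcons_cons map_rcons.
have rotS : rot (size (cone k)) (cone k.+1) = T c :: cone k.
  by rewrite coneS -cats1 rot_size_cat.
apply: (@KnotTrans _ _ (T c :: cone k)); last first.
  by rewrite -rotS; apply: KnotSym; exact: KnotRot.
have Cc : C c by exact: (nth_s (k := k.+1)).
apply: KnotTriangle.
- exact: cone_stick nk (ltnW kr).
- by rewrite -rotS; apply: stick_knot_rot; apply: cone_stick => //; exact: leqW.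
rewrite /= last_cone ?(ltnW kr) //.
move=> z [/traceE[e]]; rewrite /= inE path_edges_rcons last_cone ?(ltnW kr) //.
rewrite mem_rcons inE => ein ez.
have PP : segment (T (nth 0 s k)) P P.
  by exists 1; rewrite ler01 lexx subrr scale0r add0r scale1r.
move=> /(persp_curtain gd (nth_s (ltnW kr)) Cc)[-> //|].
move=> [p' [t [p's _ t0 [Cp' Cpt] zE]]].
have [y' [cy' ky' py']] : exists y', [/\ closed_param s y', (k <= y'.1)%N & p' = poly_pt s y'].
  case/segment_half: p's => [[u [u0 u1 ->]]|->].
    exists (k, u); split=> //; first by split=> /=; [exact: ltnW|rewrite u0].
    by rewrite /poly_pt /edge_dir /= modn_small.
  by exists (k.+1, 0); split=> //; rewrite ?vertexE //; exact: vertex_param.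
case/or3P: ein => [/eqP ee|/eqP ee|ein].
- move: ez; rewrite ee => /(persp_ray_rev gd Ch)[-> //|[t' [t'0 Ct' zE']]].
  move: zE; rewrite zE' => /(persp_inj Ct' Cpt)/sub_eq.
  rewrite py' => e'; exfalso; apply: (no_vertical (k := 0) _ cy' _ e') => // e''.
  by move: ky'; rewrite -e'' leqNgt k0.
- by apply: half_segment; rewrite -ee.
exfalso; have [y [cy yk Cy zE']] := path_point (ltnW kr) ein ez.
move: zE; rewrite zE' => /(persp_inj Cy Cpt) e'.
have : poly_pt s y - poly_pt s y' = (- t) *: d.
  by rewrite e' py' addrC addKr scaleNr.
move/(under cy cy' (leq_trans yk ky') (leq_trans nk ky')); lra.
Qed.

(* Removing the apex from the cone over the whole knot sweeps the image of the
   curtain hanging from the last edge, which is below everything. *)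
Let cone_last : knot_equiv (map T s) (cone (size r)).
Proof.
rewrite /cone take_size; apply: KnotTriangle.
- exact: st_T.1.
- by have := cone_stick nr (leqnn _); rewrite /cone take_size.
rewrite -[head _ _]/(T h) -[last P _]/(last (T h) (map T r)).
have := last_cone (leqnn (size r)); rewrite take_size => ->.
set q := nth 0 s (size r).
move=> z [/traceE[e]]; rewrite edges_map => /mapP[e' e'in ->] ez.
have [e1 e2] := mem_edges e'in.
have [x [Cx xe zE]] := persp_edges (posC e1) (posC e2) ez.
have [y cy yE] : trace s x by apply/traceE; exists e'; rewrite // [e']surjective_pairing.
move=> [t [u [k [[t0 u0 k0] tuk zE']]]].
have tri : triangle (T q) (T h) P z.
  exists t, k, u; split=> //; first by rewrite addrAC.
  by rewrite zE' addrAC.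
case: (persp_curtain gd (nth_s (leqnn _)) Ch tri) => [zP|].
  by exfalso; apply: (persp_neq_apex gd Cx); rewrite -zE.
move=> [p' [m [p's Tp's m0 [Cp' Cpm] zpm]]].
have xE : x = p' - m *: d by apply: (persp_inj Cx Cpm); rewrite -zE.
have [m00|m00] := eqVneq m 0; first by rewrite zpm m00 scale0r subr0.
have mp : 0 < m by rewrite lt_neqAle eq_sym m00.
have yp' : poly_pt s y - p' = (- m) *: d by rewrite -yE xE addrC addKr scaleNr.
exfalso; case/segment_half: p's => [[w [w0 w1 pE]]|pE].
  have pE' : p' = poly_pt s (size r, w).
    by rewrite pE poly_pt_edge ?nth_edges /= ?modnn.
  have cp : closed_param s (size r, w) by split=> //=; rewrite w0.
  have [yl|yl] := ltnP y.1 (size r).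
    by have := under cy cp yl nr; rewrite -pE' => /(_ _ yp'); lra.
  have yl' : y.1 = size r by apply/eqP; rewrite eqn_leq yl andbT; case: cy.
  have ny : y <> (size r, w).
    move=> yw; move: yp'; rewrite pE' yw subrr => /esym/eqP.
    by rewrite scaler_eq0 (negPf dn0) orbF oppr_eq0 (negPf m00).
  have := reg cy cp ny; rewrite -pE' => /(_ _ yp')[_ _].
  rewrite yl' /= => /(_ 1 (-1) 0); rewrite scale1r scaleN1r subrr scale0r.
  by move=> /(_ erefl)[/eqP]; rewrite oner_eq0.
have e3 : nth 0 s 0 - poly_pt s y = m *: d by rewrite -opprB -[nth 0 s 0]pE yp' scaleNr opprK.
apply: (no_vertical (k := 0) _ cy _ e3) => // y0.
move: e3; rewrite -y0 vertexE subrr => /esym/eqP.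
by rewrite scaler_eq0 (negPf dn0) orbF (negPf m00).
Qed.

(** Starting from the cone over the arc, the lower arc is inserted vertex by
    vertex, and the apex is removed at the end. *)
Lemma cone_knot : stick_knot (cone n) /\ knot_equiv s (cone n).
Proof.
split; first exact: cone_stick.
apply: (KnotTrans st_T.2); apply: (KnotTrans cone_last); apply: KnotSym.
have : (size r - n + n <= size r)%N by lia.
rewrite -{3}(subnK nr); elim: (size r - n)%N => [_|m IH mr]; first exact: KnotRefl.
have mr' : (m + n < size r)%N by move: mr; rewrite addSn.
by apply: (KnotTrans (IH (ltnW mr'))); apply: cone_step => //; exact: leq_addl.
Qed.

End Moves.

(** Closing a rail arc by an arc that runs below it amounts to closing it by
    two rays in direction -d; the perspectivity makes these rays meet at a
    finite apex, so a single extra vertex suffices to close the arc. *)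
Lemma cone_closure (g : 'cV[R]_3) (d : V) (A B : seq V) :
  lf g d < 0 -> (1 < size A)%N -> stick_knot (A ++ B) ->
  regular_along d (A ++ B) -> runs_under d A B ->
  (forall p, p \in A ++ B -> 0 < 1 + lf g p) ->
  stick_knot ((lf g d)^-1 *: d :: map (persp g) A) /\
  knot_equiv (A ++ B) ((lf g d)^-1 *: d :: map (persp g) A).
Proof.
case: A => [|h A'] // gd A1 st reg un pos.
have := @cone_knot g d h (A' ++ B) (size A') gd A1 _ st reg un pos.
by rewrite take_size_cat // size_cat leq_addr => /(_ isT).
Qed.

End ConeMoves.

(** * Projections along a direction *)

Section Bridge.
Context {R : realType}.
Local Notation V := 'rV[R]_3.
Implicit Types (s l : seq V) (a b d p q u v w : V) (x y z : nat * R).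

Lemma dotvE p d : dotv p d = lf d^T p. Proof. by []. Qed.

Lemma dotvDZ p t q d : dotv (p + t *: q) d = dotv p d + t * dotv q d.
Proof. by rewrite !dotvE !lfE. Qed.

Lemma dotv_gt0 d : d != 0 -> 0 < dotv d d.
Proof.
move=> d0; rewrite dotvE lf_sum.
have nn i : true -> 0 <= d 0 i * d^T i 0 by rewrite mxE; move=> _; exact: sqr_ge0.
rewrite lt_neqAle sumr_ge0 // andbT.
apply: contra d0 => /eqP/esym/psumr_eq0P h; apply/eqP/rowP => i.
by have /eqP := h nn i erefl; rewrite !mxE mulf_eq0 orbb => /eqP.
Qed.

Lemma proj_lin d k p m q : proj d (k *: p + m *: q) = k *: proj d p + m *: proj d q.
Proof. by rewrite /proj !dotvE !lfE; apply/rowP => i; rewrite !mxE; ring. Qed.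

Lemma projP d p q : d != 0 -> proj d p = proj d q <-> exists t, p - q = t *: d.
Proof.
move=> d0; have dd := dotv_gt0 d0; split=> [e|[t e]].
  exists ((dotv p d - dotv q d) / dotv d d); move: e; rewrite /proj => e.
  apply/rowP => i; have := congr1 (fun v : V => v 0 i) e; rewrite !mxE; lra.
have -> : p = q + t *: d by rewrite -e addrC subrK.
rewrite /proj !dotvE !lfE; rewrite !dotvE in dd; apply/rowP=> i; rewrite !mxE; field.
by rewrite gt_eqF.
Qed.

Lemma row_free_indep d a b : d != 0 ->
  row_free (col_mx (proj d a) (proj d b)) <-> indep_mod d a b.
Proof.
move=> d0; have dd := dotv_gt0 d0.
have lin k m : proj d (k *: a + m *: b) = 0 <-> exists t, k *: a + m *: b = t *: d.
  have := projP (k *: a + m *: b) 0 d0; rewrite subr0 => <-.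
  by rewrite [proj d 0](_ : _ = 0) // /proj dotvE /lf mul0mx mxE mul0r scale0r subr0.
split=> [rf k m t e|ind].
  have /lin : exists t, k *: a + m *: b = t *: d by exists t.
  rewrite proj_lin => h.
  have : row_mx k%:M m%:M *m col_mx (proj d a) (proj d b) = 0.
    by rewrite mul_row_col !mul_scalar_mx.
  rewrite -(mul0mx _ (col_mx (proj d a) (proj d b))) => /(row_free_inj rf).
  rewrite -row_mx0 => /eq_row_mx[/matrixP/(_ 0 0) + /matrixP/(_ 0 0)].
  by rewrite !mxE /= !mulr1n.
apply: inj_row_free => v; rewrite -[v]hsubmxK mul_row_col.
rewrite [lsubmx v]mx11_scalar [rsubmx v]mx11_scalar !mul_scalar_mx -proj_lin.
by move=> /lin[t /ind[-> ->]]; rewrite !raddf0 row_mx0.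
Qed.

Definition no_triple d s : Prop := forall x y z,
  closed_param s x -> closed_param s y -> closed_param s z ->
  forall t t', poly_pt s x - poly_pt s y = t *: d -> poly_pt s y - poly_pt s z = t' *: d ->
  [\/ x = y, y = z | x = z].

Lemma regular_projectionE d s : d != 0 -> regular_projection d s <->
  [/\ (0 < size s)%N, regular_along d s & no_triple d s].
Proof.
move=> d0; split=> [[s0 h2 h3]|[s0 h2 h3]]; split=> //.
- move=> x y cx cy xy t e; have [|x0 y0 rf] := h2 _ _ cx cy xy.
    by apply/(projP _ _ d0); exists t.
  by split=> //; apply/row_free_indep.
- move=> x y z cx cy cz t t' e e'; apply: h3 => //; apply/(projP _ _ d0).
    by exists t.
  by exists t'.
- move=> x y cx cy xy /(projP _ _ d0)[t e].
  have [x0 y0 ind] := h2 _ _ cx cy xy _ e.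
  by split=> //; apply/row_free_indep.
by move=> x y z cx cy cz /(projP _ _ d0)[t e] /(projP _ _ d0)[t' e']; exact: h3 e e'.
Qed.

Lemma regular_alongN d s : regular_along d s -> regular_along (- d) s.
Proof.
move=> h x y cx cy xy t; rewrite scalerN -scaleNr => e.
have [x0 y0 ind] := h x y cx cy xy _ e; split=> // k m t'.
by rewrite scalerN -scaleNr; exact: ind.
Qed.

Lemma poly_pt_cat A B x : (x.1.+1 < size A)%N -> poly_pt (A ++ B) x = poly_pt A x.
Proof.
move=> xA; rewrite /poly_pt /edge_dir !modn_small ?size_cat ?ltn_addr //.
by rewrite !nth_cat xA (ltnW xA).
Qed.

(** Two strands with the same projection are separated by their heights as
    soon as one of them belongs to the closing arc. *)
Lemma closes_knot d A B : d != 0 -> (0 < size (A ++ B))%N ->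
  (forall x y, closed_param (A ++ B) x -> closed_param (A ++ B) y ->
     (x.1.+1 < size A)%N -> (y.1.+1 < size A)%N ->
     poly_pt A x = poly_pt A y -> x = y) ->
  regular_along d (A ++ B) -> runs_under d A B -> stick_knot (A ++ B).
Proof.
move=> d0 s0 inj reg un; split=> // x y cx cy e; apply: contrapT => xy.
have e0 : poly_pt (A ++ B) x - poly_pt (A ++ B) y = 0 *: d by rewrite e subrr scale0r.
have e1 : poly_pt (A ++ B) y - poly_pt (A ++ B) x = 0 *: d by rewrite e subrr scale0r.
have un1 : (x.1 < y.1)%N -> ((size A).-1 <= y.1)%N -> False.
  by move=> h1 h2; have := un x y cx cy h1 h2 0 e0; rewrite ltxx.
have un2 : (y.1 < x.1)%N -> ((size A).-1 <= x.1)%N -> False.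
  by move=> h1 h2; have := un y x cy cx h1 h2 0 e1; rewrite ltxx.
have Ale k : (size A <= k.+1)%N -> ((size A).-1 <= k)%N by case: (size A).
have [xA|xA] := ltnP x.1.+1 (size A); have [yA|yA] := ltnP y.1.+1 (size A).
- by apply: xy; apply: inj => //; rewrite -(poly_pt_cat B xA) -(poly_pt_cat B yA).
- by apply: un1; [rewrite -ltnS; exact: leq_trans yA|exact: Ale].
- by apply: un2; [rewrite -ltnS; exact: leq_trans xA|exact: Ale].
have [lt|lt|eq1] := ltngtP x.1 y.1.
- by apply: un1 => //; exact: Ale.
- by apply: un2 => //; exact: Ale.
have [_ _] := reg x y cx cy xy 0 e0; rewrite eq1 => /(_ 1 (-1) 0).
by rewrite scale1r scaleN1r subrr scale0r => /(_ erefl)[/eqP]; rewrite oner_eq0.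
Qed.

Lemma arc_time_inj (i j : nat) (t u : R) : 0 <= t < 1 -> 0 <= u < 1 ->
  arc_time (i, t) = arc_time (j, u) -> (i, t) = (j, u).
Proof.
rewrite /arc_time /= => /andP[t0 t1] /andP[u0 u1] e.
have ij (k l : nat) : (k < l)%N -> k%:R + 1 <= l%:R :> R.
  by rewrite natr1 ler_nat.
have [lt|lt|eq1] := ltngtP i j.
- by exfalso; have := ij _ _ lt; lra.
- by exfalso; have := ij _ _ lt; lra.
by congr pair => //; move: e; rewrite eq1 => /addrI.
Qed.

(** A perspectivity close enough to the identity has positive denominators on
    the whole closed polygon. *)
Lemma closed_arc_knot d A B : d != 0 -> (1 < size A)%N -> stick_knot (A ++ B) ->
  regular_along d (A ++ B) -> runs_under d A B ->
  exists s, [/\ stick_knot s, knot_equiv s (A ++ B) & size s = (size A).+1].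
Proof.
move=> d0 A1 st reg un.
have dd := dotv_gt0 d0.
have [||b b0 hb] := @common_bound R _ (A ++ B) (fun p (b : R) => b * `|dotv p d| < 1).
- move=> p c c' _ le h; apply: le_lt_trans h; exact: ler_wpM2r.
- move=> p _; have p0 : 0 < `|dotv p d| + 1 by rewrite ltr_wpDl.
  exists (`|dotv p d| + 1)^-1; first by rewrite invr_gt0.
  by rewrite mulrC ltr_pdivrMr // mul1r ltrDl.
pose g : 'cV[R]_3 := - b *: d^T.
have gE p : lf g p = - b * dotv p d by rewrite /lf /g -scalemxAr mxE.
have gd : lf g d < 0 by rewrite gE mulNr oppr_lt0 mulr_gt0.
have [|st' eq] := cone_closure gd A1 st reg un.
  move=> p /hb; rewrite gE => h; have := ler_norm (dotv p d) => h'.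
  have : b * dotv p d <= b * `|dotv p d| by rewrite ler_wpM2l // ltW.
  lra.
exists ((lf g d)^-1 *: d :: map (persp g) A); split=> //; last by rewrite /= size_map.
exact: KnotSym.
Qed.

End Bridge.

(** * From rail arcs to stick knots *)

Section RailToKnot.
Context {R : realType} (L : rails R).
Local Notation V := 'rV[R]_3.
Local Notation d := (rail_dir L).

Lemma closes_under A B : closes_with L <%R A B <->
  regular_projection d (A ++ B) /\ runs_under d A B.
Proof.
have d0 := rail_dir_neq0 L; have dd := dotv_gt0 d0.
split=> -[reg un]; split=> // x y cx cy xy Ay.
  move=> t e; have pe : proj d (poly_pt (A ++ B) x) = proj d (poly_pt (A ++ B) y).
    by apply/projP => //; exists t.
  have := un x y cx cy xy Ay pe; rewrite /height.
  have -> : poly_pt (A ++ B) x = poly_pt (A ++ B) y + t *: d by rewrite -e addrC subrK.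
  by rewrite dotvDZ ltrDl pmulr_lgt0.
move=> /projP -/(_ d0)[t e]; have := un x y cx cy xy Ay t e.
rewrite /height.
have -> : poly_pt (A ++ B) x = poly_pt (A ++ B) y + t *: d by rewrite -e addrC subrK.
by rewrite dotvDZ ltrDl pmulr_lgt0.
Qed.

Lemma closes_over A B : closes_with L >%R A B <->
  regular_projection d (A ++ B) /\ runs_under (- d) A B.
Proof.
have d0 := rail_dir_neq0 L; have dd := dotv_gt0 d0.
split=> -[reg un]; split=> // x y cx cy xy Ay.
  move=> t e; have e' : poly_pt (A ++ B) x - poly_pt (A ++ B) y = (- t) *: d.
    by rewrite e scalerN scaleNr.
  have pe : proj d (poly_pt (A ++ B) x) = proj d (poly_pt (A ++ B) y).
    by apply/projP => //; exists (- t).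
  have := un x y cx cy xy Ay pe; rewrite /height /=.
  have -> : poly_pt (A ++ B) x = poly_pt (A ++ B) y + (- t) *: d by rewrite -e' addrC subrK.
  by rewrite dotvDZ gtrDl pmulr_llt0 // oppr_lt0.
move=> /projP -/(_ d0)[t e]; have := un x y cx cy xy Ay (- t).
rewrite scalerN scaleNr opprK => /(_ e); rewrite /height /=.
have -> : poly_pt (A ++ B) x = poly_pt (A ++ B) y + t *: d by rewrite -e addrC subrK.
by rewrite oppr_gt0 dotvDZ gtrDl pmulr_llt0.
Qed.

Lemma rail_arc_knot A B (e : V) : e != 0 -> stick_rail_arc L A ->
  (0 < size (A ++ B))%N -> regular_along e (A ++ B) -> runs_under e A B ->
  stick_knot (A ++ B).
Proof.
move=> e0 [A1 inj _ _ _] s0 reg un; apply: (closes_knot e0) => //.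
move=> [i t] [j u] [_ /= /andP[t0 t1]] [_ /= /andP[u0 u1]] iA jA eq.
apply: arc_time_inj; rewrite ?t0 ?u0 //; apply: inj => //.
  by split=> //=; rewrite t0 ltW.
by split=> //=; rewrite u0 ltW.
Qed.

(** The over companion is an under companion for the opposite direction. *)
Lemma companion_stick_knot A (K : seq V) : stick_rail_arc L A ->
  under_companion L A K \/ over_companion L A K ->
  exists s, [/\ stick_knot s, knot_equiv s K & size s = (size A).+1].
Proof.
move=> arc; have [A1 _ _ _ _] := arc; have d0 := rail_dir_neq0 L.
case=> [[B /closes_under[/regular_projectionE -/(_ d0)[s0 reg _] un] eqK]|
        [B /closes_over[/regular_projectionE -/(_ d0)[s0 reg _] un] eqK]].
  have st := rail_arc_knot d0 arc s0 reg un.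
  have [s [sts eqs szs]] := closed_arc_knot d0 A1 st reg un.
  by exists s; split=> //; exact: KnotTrans eqK.
have d0' : - d != 0 by rewrite oppr_eq0.
have reg' := regular_alongN reg.
have st := rail_arc_knot d0' arc s0 reg' un.
have [s [sts eqs szs]] := closed_arc_knot d0' A1 st reg' un.
by exists s; split=> //; exact: KnotTrans eqK.
Qed.

End RailToKnot.

(** * Polygons in general position *)

Section GeneralPosition.
Context {R : realType}.
Local Notation V := 'rV[R]_3.
Implicit Types (s : seq V) (d p q : V).

(** Coordinates on the plane of lines parallel to d, together with vectors that
    witness their independence. *)
Lemma planar_coordinates d : d != 0 -> exists gx gy : 'cV[R]_3,
  [/\ lf gx d = 0, lf gy d = 0,
      forall p, lf gx p = 0 -> lf gy p = 0 -> exists t, p = t *: d,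
      exists p, lf gx p = 1 /\ lf gy p = 0 &
      exists p, lf gx p = 0 /\ lf gy p = 1].
Proof.
move=> d0; pose B := row_ebase d; pose M := invmx B.
have Bu : B \in unitmx by exact: row_ebase_unit.
have r1 : \rank d = 1%N by rewrite rank_rV d0.
have := mulmx_ebase d; rewrite r1 -/B [col_ebase d]mx11_scalar => dE.
set c := col_ebase d 0 0 in dE.
have c0 : c != 0.
  by apply: contra d0 => /eqP c0; rewrite -dE c0 mul_scalar_mx scale0r mul0mx.
have dE' : d = c *: (pid_mx 1 *m B) by rewrite -{1}dE mul_scalar_mx scalemxAl.
have lfc p j : lf (col j M) p = (p *m M) 0 j by rewrite /lf colE mulmxA -colE mxE.
have pidE : (pid_mx 1 : V) = delta_mx 0 0.
  by apply/rowP => j; rewrite !mxE; case: j => -[|[|[|]]].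
have dM j : (d *m M) 0 j = c * (j == 0)%:R.
  by rewrite dE' -scalemxAl mulmxK // pidE !mxE.
exists (col 1 M), (col 2%:R M); split.
- by rewrite lfc dM mulr0.
- by rewrite lfc dM mulr0.
- move=> p; rewrite !lfc => p1 p2; exists ((p *m M) 0 0 / c).
  rewrite {1}dE' scalerA divfK // -[LHS](mulmxKV Bu) -/M scalemxAl; congr (_ *m _).
  rewrite pidE; apply/rowP => j; rewrite [RHS]mxE [X in _ * X]mxE eqxx /=.
  case: j => -[|[|[|//]]] lt3.
  + by rewrite mulr1; congr ((p *m M) _ _); exact: val_inj.
  + by rewrite mulr0 -[RHS]p1; congr ((p *m M) _ _); exact: val_inj.
  + by rewrite mulr0 -[RHS]p2; congr ((p *m M) _ _); exact: val_inj.
- by exists (delta_mx 0 1 *m B); rewrite !lfc mulmxK // !mxE.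
- by exists (delta_mx 0 2%:R *m B); rewrite !lfc mulmxK // !mxE.
Qed.

(** Twice the signed area of a triangle in the plane. *)
Definition cross (ax ay bx by' cx cy : R) : R :=
  (bx - ax) * (cy - ay) - (by' - ay) * (cx - ax).

Lemma cross_consecutive (ax ay bx by' cx cy t u : R) : t < 1 ->
  ax + t * (bx - ax) = bx + u * (cx - bx) ->
  ay + t * (by' - ay) = by' + u * (cy - by') -> cross ax ay bx by' cx cy = 0.
Proof.
move=> t1 ex ey; have : (1 - t) * cross ax ay bx by' cx cy = 0.
  have -> : (1 - t) * cross ax ay bx by' cx cy =
    (ay + t * (by' - ay) - (by' + u * (cy - by'))) * (cx - bx) -
    (ax + t * (bx - ax) - (bx + u * (cx - bx))) * (cy - by').
    by rewrite /cross; ring.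
  by rewrite ex ey !subrr !mul0r subrr.
by move=> /eqP; rewrite mulf_eq0 => /orP[/eqP|/eqP //]; lra.
Qed.

Lemma cross_on_line (ax ay bx by' cx cy u : R) :
  cx = ax + u * (bx - ax) -> cy = ay + u * (by' - ay) -> cross ax ay bx by' cx cy = 0.
Proof. by move=> -> ->; rewrite /cross; ring. Qed.

Lemma cross_parallel (ax ay bx by' cx cy ex ey t u : R) :
  ax + t * (bx - ax) = cx + u * (ex - cx) -> ay + t * (by' - ay) = cy + u * (ey - cy) ->
  (bx - ax) * (ey - cy) - (by' - ay) * (ex - cx) = 0 -> cross ax ay bx by' cx cy = 0.
Proof.
move=> e1 e2 det0.
have -> : cross ax ay bx by' cx cy =
   (bx - ax) * (ay + t * (by' - ay) - u * (ey - cy) - ay) -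
   (by' - ay) * (ax + t * (bx - ax) - u * (ex - cx) - ax).
  by rewrite e1 e2 /cross; ring.
have := congr1 (fun z => u * z) det0; rewrite mulr0; lra.
Qed.

Section Planar.
Variables (d : V) (gx gy : 'cV[R]_3).
Local Notation X p := (lf gx p).
Local Notation Y p := (lf gy p).
Hypothesis Xd : X d = 0.
Hypothesis Yd : Y d = 0.
Hypothesis XY0 : forall p, X p = 0 -> Y p = 0 -> exists t, p = t *: d.
Hypothesis exX : exists p, X p = 1 /\ Y p = 0.
Hypothesis exY : exists p, X p = 0 /\ Y p = 1.
Let D a b q := cross (X a) (Y a) (X b) (Y b) (X q) (Y q).

Lemma planar_avoid (I : finType) (P : pred I) (a b c : I -> R) (p0 : V) (eps : R) :
  (forall i, P i -> ~ [/\ a i = 0, b i = 0 & c i = 0]) -> 0 < eps ->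
  exists2 p, close eps p p0 & forall i, P i -> a i * X p + b i * Y p + c i != 0.
Proof.
move=> nz eps0; pose g i : 'cV[R]_3 := a i *: gx + b i *: gy.
have gE i p : lf (g i) p = a i * X p + b i * Y p.
  by rewrite /lf mulmxDr -!scalemxAr !mxE.
have [|p pc h] := @avoid_planes R I P g c p0 eps _ eps0.
  move=> i Pi; have [g0|] := eqVneq (g i) 0; [right|by left].
  apply/eqP => c0; apply: (nz i Pi); split=> //.
    have [p [px py]] := exX; have := gE i p.
    by rewrite g0 px py /lf mulmx0 mxE; lra.
  have [p [px py]] := exY; have := gE i p.
  by rewrite g0 px py /lf mulmx0 mxE; lra.
by exists p => // i Pi; rewrite -gE; exact: h.
Qed.

(** All pairs of vertices are considered, not only edges, so that vertices can
    be added one by one; by the first condition any two of them span a line. *)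
Definition general_position s : Prop :=
  [/\ forall i j, (i < size s)%N -> (j < size s)%N -> i != j -> X (nth 0 s i) <> X (nth 0 s j),
      forall i j k, all (gtn (size s)) [:: i; j; k] -> uniq [:: i; j; k] ->
        D (nth 0 s i) (nth 0 s j) (nth 0 s k) <> 0 &
      forall i i' j j' k k', all (gtn (size s)) [:: i; i'; j; j'; k; k'] ->
        uniq [:: i; i'; j; j'; k; k'] -> forall q,
        D (nth 0 s i) (nth 0 s i') q = 0 -> D (nth 0 s j) (nth 0 s j') q = 0 ->
        D (nth 0 s k) (nth 0 s k') q = 0 -> False].

(** The new vertex has to avoid finitely many lines of the plane.  For the last
    condition these are the lines through a vertex j and the common point
    of two lines k l and m o; with that point in homogeneous coordinates (U : W : Z)
    the line has polynomial coefficients, also when the two lines are parallel.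
    They do not all vanish, since otherwise j is on k l, or the two lines
    coincide. *)
Lemma general_position_cons s p0 eps : general_position s -> 0 < eps ->
  exists2 p, close eps p p0 & general_position (p :: s).
Proof.
move=> [N2 N3 N6] eps0; set n := size s.
pose x i := X (nth 0 s i); pose y i := Y (nth 0 s i).
pose la k l := y k - y l; pose lb k l := x l - x k; pose lc k l := x k * y l - y k * x l.
pose U k l m o := lb k l * lc m o - lc k l * lb m o.
pose W k l m o := lc k l * la m o - la k l * lc m o.
pose Z k l m o := la k l * lb m o - lb k l * la m o.
pose I := ('I_n + 'I_n * 'I_n + 'I_n * 'I_n * 'I_n * 'I_n * 'I_n)%type.
pose P (i : I) := match i with
  | inl (inl _) => true
  | inl (inr (j, k)) => j != k
  | inr (j, k, l, m, o) => uniq [:: val j; val k; val l; val m; val o] end.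
pose ca (i : I) := match i with
  | inl (inl _) => 1
  | inl (inr (j, k)) => la j k
  | inr (j, k, l, m, o) => y j * Z k l m o - W k l m o end.
pose cb (i : I) := match i with
  | inl (inl _) => 0
  | inl (inr (j, k)) => lb j k
  | inr (j, k, l, m, o) => U k l m o - x j * Z k l m o end.
pose cc (i : I) := match i with
  | inl (inl j) => - x j
  | inl (inr (j, k)) => lc j k
  | inr (j, k, l, m, o) => x j * W k l m o - y j * U k l m o end.
have nz i : P i -> ~ [/\ ca i = 0, cb i = 0 & cc i = 0].
  case: i => [[j|[j k]]|[[[[j k] l] m] o]] /=.
  - by move=> _ [/eqP]; rewrite oner_eq0.
  - move=> jk [_ e _]; apply: (N2 j k) => //.
    by move: e; rewrite /lb /x; lra.
  rewrite !inE !negb_or -!andbA => /and5P[jk jl jm jo /and5P[kl km ko lm /and3P[lo mo _]]].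
  move=> [e1 e2 e3].
  have Dj : cross (x k) (y k) (x l) (y l) (x j) (y j) <> 0.
    apply: (N3 k l j); rewrite /= ?ltn_ord //.
    by rewrite !inE !negb_or kl eq_sym jk eq_sym jl.
  have Dm : cross (x k) (y k) (x l) (y l) (x m) (y m) <> 0.
    apply: (N3 k l m); rewrite /= ?ltn_ord //.
    by rewrite !inE !negb_or kl km lm.
  have xmo : x m <> x o by exact: N2.
  have Z0 : Z k l m o = 0.
    have : Z k l m o * cross (x k) (y k) (x l) (y l) (x j) (y j) = 0.
      have -> : Z k l m o * cross (x k) (y k) (x l) (y l) (x j) (y j) =
        la k l * (x j * Z k l m o - U k l m o) + lb k l * (y j * Z k l m o - W k l m o).
        by rewrite /Z /U /W /cross /la /lb /lc; ring.
      by rewrite e1 -opprB e2 oppr0 !mulr0 addr0.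
    by move=> /eqP; rewrite mulf_eq0 => /orP[/eqP|/eqP].
  have W0 : W k l m o = 0 by rewrite Z0 mulr0 in e1; lra.
  have U0 : U k l m o = 0 by rewrite Z0 mulr0 in e2; lra.
  apply: Dm.
  have h1 : cross (x k) (y k) (x l) (y l) (x m) (y m) =
            cross (x k) (y k) (x l) (y l) (x o) (y o).
    move: Z0; rewrite /Z /cross /la /lb; lra.
  have : (x m - x o) * cross (x k) (y k) (x l) (y l) (x m) (y m) = 0.
    have e4 : x m * cross (x k) (y k) (x l) (y l) (x o) (y o) -
      x o * cross (x k) (y k) (x l) (y l) (x m) (y m) = 0.
      by move: U0; rewrite /U /cross /la /lb /lc; lra.
    by rewrite mulrBl {1}h1.
  by move=> /eqP; rewrite mulf_eq0 subr_eq0 => /orP[/eqP|/eqP].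
have [p pc h] := planar_avoid p0 nz eps0.
exists p => //.
have h2 j : (j < n)%N -> X p <> X (nth 0 s j).
  move=> jn e; have := h (inl (inl (Ordinal jn))) isT.
  by rewrite /= mul0r mul1r addr0 e subrr eqxx.
have h3 j k : (j < n)%N -> (k < n)%N -> j != k -> D p (nth 0 s j) (nth 0 s k) <> 0.
  move=> jn kn jk e; have := h (inl (inr (Ordinal jn, Ordinal kn))) jk.
  move/eqP; apply; move: e; rewrite /D /cross /= /la /lb /lc /x /y; lra.
have h6 j k l m o : all (gtn n) [:: j; k; l; m; o] -> uniq [:: j; k; l; m; o] ->
    forall q, D p (nth 0 s j) q = 0 -> D (nth 0 s k) (nth 0 s l) q = 0 ->
    D (nth 0 s m) (nth 0 s o) q = 0 -> False.
  rewrite /= => /and5P[jn kn ln mn /andP[on _]] un q.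
  have := h (inr (Ordinal jn, Ordinal kn, Ordinal ln, Ordinal mn, Ordinal on)) un.
  rewrite /= => /eqP nz0; rewrite /D -/(x j) -/(y j) -/(x k) -/(y k) -/(x l) -/(y l).
  rewrite -/(x m) -/(y m) -/(x o) -/(y o) => e1 e2 e3; apply: nz0.
  have E2 : la k l * X q + lb k l * Y q + lc k l = 0.
    by rewrite -[RHS]e2 /cross /la /lb /lc; ring.
  have E3 : la m o * X q + lb m o * Y q + lc m o = 0.
    by rewrite -[RHS]e3 /cross /la /lb /lc; ring.
  have c1 : lc k l = - (la k l * X q + lb k l * Y q) by lra.
  have c2 : lc m o = - (la m o * X q + lb m o * Y q) by lra.
  have UE : U k l m o = Z k l m o * X q by rewrite /U /Z c1 c2; ring.
  have WE : W k l m o = Z k l m o * Y q by rewrite /W /Z c1 c2; ring.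
  have := congr1 (fun t => Z k l m o * t) e1; rewrite UE WE mulr0 => <-.
  by rewrite /cross; ring.
have nthS k : (0 < k)%N -> nth 0 (p :: s) k = nth 0 s k.-1 by case: k.
have Dsym (a b q : V) : D a b q = 0 -> D b a q = 0 by rewrite /D /cross; lra.
split.
- move=> [|i] [|j] //= ilt jlt ij; [exact: h2|move/esym; exact: h2|exact: N2].
- move=> i j k; rewrite /= !inE => lts un.
  have [i0|i0] := posnP i.
    by rewrite i0 (nthS j) ?(nthS k) /=; [apply: h3; lia|lia|lia].
  have [j0|j0] := posnP j.
    rewrite j0 (nthS i) ?(nthS k) /=; [move=> e|lia|lia].
    by apply: (h3 i.-1 k.-1); [lia|lia|lia|move: e; rewrite /D /cross; lra].
  have [k0|k0] := posnP k.
    rewrite k0 (nthS i) ?(nthS j) /=; [move=> e|lia|lia].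
    by apply: (h3 i.-1 j.-1); [lia|lia|lia|move: e; rewrite /D /cross; lra].
  by rewrite !nthS //; apply: N3; rewrite /= ?inE; lia.
pose G L := uniq L && all (fun a => a <= n)%N L.
have Gperm L L' : perm_eq L L' -> G L -> G L'.
  by move=> e; rewrite /G (perm_uniq e) (perm_all _ e).
have Gpred L : all (ltn 0) L -> G L ->
    uniq (map predn L) && all (gtn n) (map predn L).
  move=> /allP pos /andP[un /allP le]; rewrite map_inj_in_uniq ?un /=; last first.
    by move=> a b /pos + /pos; case: a b => [|a] [|b] //= _ _ ->.
  by apply/allP => _ /mapP[a aL ->]; have := le a aL; have := pos a aL; case: a {aL}.
have Gpos L : G (0%N :: L) -> all (ltn 0) L /\ G L.
  rewrite /G /= -!andbA => /and3P[L0 un le]; rewrite un le; split=> //.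
  by apply/allP => a aL; rewrite /= lt0n; apply: contraNneq L0 => <-.
have h60 j k l m o : G [:: 0; j; k; l; m; o]%N -> forall q,
    D p (nth 0 (p :: s) j) q = 0 -> D (nth 0 (p :: s) k) (nth 0 (p :: s) l) q = 0 ->
    D (nth 0 (p :: s) m) (nth 0 (p :: s) o) q = 0 -> False.
  move=> /Gpos[pos g] q; have /andP[un le] := Gpred _ pos g.
  move: pos => /and5P[j0 k0 l0 m0 /andP[o0 _]]; rewrite !nthS //.
  exact: h6.
move=> i i' j j' k k' lts un q e1 e2 e3.
have g : G [:: i; i'; j; j'; k; k'] by rewrite /G un; exact: lts.
have gi' := Gperm _ _ (permEl (perm_catCA [:: i] [:: i'] _)) g.
have gj := Gperm _ _ (permEl (perm_catCA [:: i; i'] [:: j; j'] _)) g.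
have gj' := Gperm _ _ (permEl (perm_catCA [:: j] [:: j'] _)) gj.
have gk := Gperm _ _ (permEl (perm_catCA [:: i; i'; j; j'] [:: k; k'] [::])) g.
have gk' := Gperm _ _ (permEl (perm_catCA [:: k] [:: k'] _)) gk.
have [i0|i0] := posnP i; first by rewrite i0 in g e1; exact: h60 g _ e1 e2 e3.
have [i'0|i'0] := posnP i'.
  by rewrite i'0 in gi' e1; exact: h60 gi' _ (Dsym _ _ _ e1) e2 e3.
have [j0|j0] := posnP j; first by rewrite j0 in gj e2; exact: h60 gj _ e2 e1 e3.
have [j'0|j'0] := posnP j'.
  by rewrite j'0 in gj' e2; exact: h60 gj' _ (Dsym _ _ _ e2) e1 e3.
have [k0|k0] := posnP k; first by rewrite k0 in gk e3; exact: h60 gk _ e3 e1 e2.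
have [k'0|k'0] := posnP k'.
  by rewrite k'0 in gk' e3; exact: h60 gk' _ (Dsym _ _ _ e3) e1 e2.
have pos : all (ltn 0) [:: i; i'; j; j'; k; k'] by rewrite /= i0 i'0 j0 j'0 k0 k'0.
have /andP[unp lep] := Gpred _ pos g.
rewrite !nthS // in e1 e2 e3.
exact: (N6 _ _ _ _ _ _ lep unp q e1 e2 e3).
Qed.

Lemma general_position_approx s eps : 0 < eps -> exists2 s', close_seq eps s s' & general_position s'.
Proof.
move=> eps0; elim: s => [|p0 s [s' [sz cs] gs]].
  by exists [::] => //; split=> // i j; rewrite subrr normr0.
have [p pc gen_s] := general_position_cons p0 gs eps0.
by exists (p :: s') => //; split=> [|[|i]] //=; rewrite sz.
Qed.

Section Regular.
Variable s : seq V.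
Hypothesis gen_s : general_position s.
Hypothesis s3 : (2 < size s)%N.
Local Notation "i ^+" := (i.+1 %% size s)%N (at level 2, format "i ^+").

Let vertical p q t : p - q = t *: d -> X p = X q /\ Y p = Y q.
Proof.
move=> e; have -> : p = q + t *: d by rewrite -e addrC subrK.
by rewrite !lfE Xd Yd mulr0 !addr0.
Qed.

Let next i : (i < size s)%N -> (i^+ = i.+1 /\ i.+1 < size s \/ i^+ = 0 /\ i.+1 = size s)%N.
Proof.
by rewrite leq_eqVlt => /orP[/eqP e|h]; [right; rewrite e modnn|left; rewrite modn_small].
Qed.

(* Three distinct collinear vertices would result from a double point on
   consecutive edges, at a vertex, or on parallel edges. *)
Let cross_param i j t u : (i < size s)%N -> (j < size s)%N ->
  0 <= t < 1 -> 0 <= u < 1 -> (i, t) <> (j, u) ->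
  X (poly_pt s (i, t)) = X (poly_pt s (j, u)) ->
  Y (poly_pt s (i, t)) = Y (poly_pt s (j, u)) ->
  [/\ uniq [:: i; i^+; j; j^+], 0 < t, 0 < u &
      (X (nth 0 s i^+) - X (nth 0 s i)) * (Y (nth 0 s j^+) - Y (nth 0 s j)) -
      (Y (nth 0 s i^+) - Y (nth 0 s i)) * (X (nth 0 s j^+) - X (nth 0 s j)) != 0].
Proof.
have [N2 N3 _] := gen_s.
move=> il jl /andP[t0 t1] /andP[u0 u1] ne; rewrite /poly_pt /edge_dir /= !lfE => eX eY.
have il' : (i^+ < size s)%N by rewrite ltn_pmod // (leq_ltn_trans _ il).
have jl' : (j^+ < size s)%N by rewrite ltn_pmod // (leq_ltn_trans _ jl).
have ni := next il; have nj := next jl.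
have [eij|ij] := eqVneq i j.
  exfalso; move: eX; rewrite -eij => eX; apply: ne; rewrite -eij; congr pair.
  have : (t - u) * (X (nth 0 s i^+) - X (nth 0 s i)) = 0 by lra.
  move=> /eqP; rewrite mulf_eq0 !subr_eq0 => /orP[/eqP //|/eqP e].
  by exfalso; apply: (N2 i^+ i) e => //; lia.
have [eij'|ij'] := eqVneq i^+ j.
  exfalso; apply: (N3 i j j^+); rewrite /= ?inE; [lia|lia|].
  rewrite eij' in eX eY; apply: cross_consecutive eX eY; lra.
have [eji'|ji'] := eqVneq j^+ i.
  exfalso; apply: (N3 j i i^+); rewrite /= ?inE; [lia|lia|].
  rewrite eji' in eX eY; apply: (cross_consecutive (t := u) (u := t)); [lra|by symmetry|by symmetry].
have un : uniq [:: i; i^+; j; j^+] by rewrite /= !inE; lia.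
split=> //.
- rewrite lt_neqAle t0 andbT; apply/eqP => t00.
  apply: (N3 j j^+ i); rewrite /= ?inE; [lia|lia|].
  by apply: (cross_on_line (u := u)); [move: eX|move: eY]; rewrite -t00 mul0r addr0.
- rewrite lt_neqAle u0 andbT; apply/eqP => u00.
  apply: (N3 i i^+ j); rewrite /= ?inE; [lia|lia|].
  by apply: (cross_on_line (u := t)); [move: eX|move: eY]; rewrite -u00 mul0r addr0.
apply/eqP => det0; apply: (N3 i i^+ j); rewrite /= ?inE; [lia|lia|].
exact: cross_parallel eX eY det0.
Qed.

Lemma general_position_regular : regular_along d s.
Proof.
move=> [i t] [j u] [il tl] [jl ul] xy k /vertical[eX eY].
have [_ t0 u0 det] := cross_param il jl tl ul xy eX eY; split=> // a b c e.
have := congr1 (lf gx) e; have := congr1 (lf gy) e.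
rewrite /edge_dir /= !lfE Xd Yd mulr0 => EY EX.
move: det EX EY; set A := X _ - _; set B := Y _ - _; set A' := Y _ - _; set B' := X _ - _.
move=> det EX EY.
have ha : a * (A * B - A' * B') = 0.
  have := congr1 (fun t => t * B) EX; have := congr1 (fun t => t * B') EY; lra.
have hb : b * (A * B - A' * B') = 0.
  have := congr1 (fun t => t * A') EX; have := congr1 (fun t => t * A) EY; lra.
by split; apply/eqP; [move/eqP: ha|move/eqP: hb]; rewrite mulf_eq0 (negPf det) orbF.
Qed.

Lemma general_position_no_triple : no_triple d s.
Proof.
move=> [i t] [j u] [k w] [il tl] [jl ul] [kl wl] m m' /vertical[eX eY] /vertical[eX' eY'].
have [h1|h1] := pselect ((i, t) = (j, u)); first by constructor 1.
have [h2|h2] := pselect ((j, u) = (k, w)); first by constructor 2.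
have [h3|h3] := pselect ((i, t) = (k, w)); first by constructor 3.
exfalso.
have [u1 _ _ _] := cross_param il jl tl ul h1 eX eY.
have [u2 _ _ _] := cross_param jl kl ul wl h2 eX' eY'.
have [u3 _ _ _] := cross_param il kl tl wl h3 (etrans eX eX') (etrans eY eY').
have [_ _ N6] := gen_s.
have lt l : (l < size s)%N -> (l^+ < size s)%N.
  by move=> ll; rewrite ltn_pmod // (leq_ltn_trans _ ll).
have un : uniq [:: i; i^+; j; j^+; k; k^+].
  have -> : [:: i; i^+; j; j^+; k; k^+] = [:: i; i^+; j; j^+] ++ [:: k; k^+] by [].
  rewrite cat_uniq u1; move: u2 u3; rewrite /= !inE !negb_or -!andbA.
  move=> /and5P[_ a1 a2 a3 /and3P[a4 a5 _]] /and5P[_ b1 b2 b3 /and3P[b4 _ _]].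
  by rewrite a5 ![k == _]eq_sym ![k^+ == _]eq_sym
    (negPf a1) (negPf a2) (negPf a3) (negPf a4) (negPf b1) (negPf b2) (negPf b3) (negPf b4).
have on l (v : R) : D (nth 0 s l) (nth 0 s l^+) (poly_pt s (l, v)) = 0.
  by rewrite /D /cross /poly_pt /edge_dir !lfE /=; ring.
apply: (N6 i i^+ j j^+ k k^+ _ un (poly_pt s (i, t))) => //.
- by rewrite /= il jl kl !lt.
- by rewrite /D eX eY; exact: on.
- by rewrite /D (etrans eX eX') (etrans eY eY'); exact: on.
Qed.

End Regular.

End Planar.

(** General position constrains the vertices only, yet it decides regularity:
    a bad double point makes three vertices collinear, and a triple point makes
    the lines spanned by three disjoint pairs of vertices concurrent. *)
Lemma perturb_regular d s eps : d != 0 -> (2 < size s)%N -> 0 < eps ->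
  exists s', [/\ close_seq eps s s', regular_along d s' & no_triple d s'].
Proof.
move=> d0 s3 eps0; have [gx [gy [Xd Yd XY exX exY]]] := planar_coordinates d0.
have [s' c g] := general_position_approx exX exY s eps0.
have s3' : (2 < size s')%N by case: c => ->.
by exists s'; split=> //; [apply: general_position_regular g s3'|apply: general_position_no_triple g s3'].
Qed.
End GeneralPosition.

(** * Linear maps that preserve knot classes *)

Section Alignment.
Context {R : realType}.
Local Notation V := 'rV[R]_3.
Implicit Types (s : seq V) (a b c d u v w x : V) (M : 'M[R]_3).

Definition preserves_knots (f : V -> V) : Prop := forall s, stick_knot s ->
  stick_knot (map f s) /\ knot_equiv s (map f s).

Lemma preserves_knots_comp f f' : preserves_knots f -> preserves_knots f' ->
  preserves_knots (f' \o f).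
Proof.
move=> h h' s /h[st e]; have [st' e'] := h' _ st.
by rewrite map_comp; split=> //; exact: KnotTrans e'.
Qed.

Lemma preserves_knots_shift v : preserves_knots (fun x => x + v).
Proof.
move=> s st; have lf0 x : lf 0 x = 0 by rewrite /lf mulmx0 mxE.
have := @knot_transvection R 0 1 v 0 s st; rewrite lf0 mul0r !addr0 ltr01.
have -> : map (transvection 0 1 v 0) s = map (fun x => x + v) s.
  apply: eq_map => x.
  by rewrite /transvection lf0 mul0r addr0 add0r invr1 !scale1r.
by apply=> // x _; rewrite mul0r addr0 ltr01.
Qed.

Definition admissible M : Prop := M \in unitmx /\ preserves_knots (mulmx^~ M).

Lemma admissible_mul M M' : admissible M -> admissible M' -> admissible (M *m M').
Proof.
move=> [Mu h] [Mu' h']; split; first by rewrite unitmx_mul Mu.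
have -> : mulmx^~ (M *m M') = (mulmx^~ M' \o mulmx^~ M : V -> V).
  by apply/funext => x /=; rewrite mulmxA.
exact: preserves_knots_comp.
Qed.

Lemma admissible_transvection (g : 'cV[R]_3) u : 0 < 1 + lf g u -> admissible (1%:M + g *m u).
Proof.
move=> pos; have E x : x *m (1%:M + g *m u) = x + lf g x *: u.
  by rewrite mulmxDr mulmx1 mulmxA [x *m g]mx11_scalar mul_scalar_mx.
split.
  rewrite -row_free_unit; apply: inj_row_free => x; rewrite E => e.
  have := congr1 (lf g) e; rewrite !lfE lfv0 => h.
  have : lf g x * (1 + lf g u) = 0 by rewrite mulrDr mulr1.
  move=> /eqP; rewrite mulf_eq0 [1 + _ == 0]gt_eqF // orbF => /eqP g0.
  by move: e; rewrite g0 scale0r addr0.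
move=> s st; have := @knot_transvection R g 0 u 0 s st.
have -> : map (transvection g 0 u 0) s = map (mulmx^~ (1%:M + g *m u)) s.
  apply: eq_map => x /=.
  by rewrite /transvection E mul0r !addr0 invr1 scale1r.
by rewrite mul0r addr0; apply=> // x _; rewrite mul0r addr0 ltr01.
Qed.

Definition indep2 a b : Prop := forall k m : R, k *: a + m *: b = 0 -> k = 0 /\ m = 0.

Definition indep3 a b c : Prop := forall k m n : R,
  k *: a + m *: b + n *: c = 0 -> [/\ k = 0, m = 0 & n = 0].

Lemma dual_basis3 a b c : indep3 a b c ->
  exists g : 'cV[R]_3, [/\ lf g a = 0, lf g b = 1 & lf g c = 1].
Proof.
move=> ind; pose M := col_mx a (col_mx b c).
have : row_free M.
  apply: inj_row_free => v; rewrite -[v]hsubmxK mul_row_col -[rsubmx v]hsubmxK mul_row_col.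
  rewrite [lsubmx v]mx11_scalar [lsubmx (rsubmx v)]mx11_scalar [rsubmx (rsubmx v)]mx11_scalar.
  by rewrite !mul_scalar_mx addrA => /ind[-> -> ->]; rewrite !raddf0 !row_mx0.
move=> /row_freeP[B MB]; exists (B *m col_mx (0 : 'M_1) (col_mx 1 1)).
have : M *m (B *m col_mx 0 (col_mx 1 1)) = col_mx (0 : 'M_1) (col_mx 1 1).
  by rewrite mulmxA MB mul1mx.
rewrite /M !mul_col_mx => /eq_col_mx[ha /eq_col_mx[hb hc]].
by rewrite /lf ha hb hc !mxE.
Qed.

(** The transvection p + g p (c - b), where g vanishes at a and is 1 at b
    and at c, has determinant 1. *)
Lemma move_fixing a b c : indep3 a b c ->
  exists M, [/\ admissible M, a *m M = a & b *m M = c].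
Proof.
move=> /dual_basis3[g [ga gb gc]]; exists (1%:M + g *m (c - b)).
have E x : x *m (1%:M + g *m (c - b)) = x + lf g x *: (c - b).
  by rewrite mulmxDr mulmx1 mulmxA [x *m g]mx11_scalar mul_scalar_mx.
split.
- by apply: admissible_transvection; rewrite lfB gb gc subrr addr0 ltr01.
- by rewrite E ga scale0r addr0.
- by rewrite E gb scale1r addrC subrK.
Qed.

Lemma off_planes (g h : 'cV[R]_3) : g != 0 -> h != 0 ->
  exists p, lf g p <> 0 /\ lf h p <> 0.
Proof.
move=> g0 h0; have [|p _ hp] := @avoid_planes R bool predT
  (fun i => if i then g else h) (fun=> 0) 0 1 _ ltr01.
  by case; left.
by exists p; have := hp true isT; have := hp false isT; rewrite !addr0 => /eqP ? /eqP ?.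
Qed.

Lemma indep3_off (g : 'cV[R]_3) a b c : indep2 a b -> lf g a = 0 -> lf g b = 0 ->
  lf g c <> 0 -> indep3 a b c.
Proof.
move=> ind ga gb gc k m n e; have := congr1 (lf g) e.
rewrite !lfE ga gb !mulr0 !add0r lfv0 => /eqP.
rewrite mulf_eq0 => /orP[/eqP n0|/eqP //].
by move: e; rewrite n0 scale0r addr0 => /ind[-> ->].
Qed.

Lemma indep3_perm a b c : indep3 a b c -> indep3 a c b.
Proof.
move=> ind k m n e; suff [-> -> ->] : [/\ k = 0, n = 0 & m = 0] by [].
by apply: ind; rewrite addrAC.
Qed.

Lemma indep2_mul M a b : M \in unitmx -> indep2 a b -> indep2 (a *m M) (b *m M).
Proof.
move=> Mu ind k m; rewrite !scalemxAl -mulmxDl => e; apply: ind.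
by rewrite -[LHS](mulmxK Mu) e mul0mx.
Qed.

(** A third vector independent of both positions serves as an intermediate
    stop. *)
Lemma move_second a b c : indep2 a b -> indep2 a c ->
  exists M, [/\ admissible M, a *m M = a & b *m M = c].
Proof.
move=> ab ac; have [g1 g10 [g1a g1b]] := annihilator a b.
have [g2 g20 [g2a g2c]] := annihilator a c.
have [p [p1 p2]] := off_planes g10 g20.
have [M1 [G1 a1 b1]] := move_fixing (indep3_off ab g1a g1b p1).
have [M2 [G2 a2 b2]] := move_fixing (indep3_perm (indep3_off ac g2a g2c p2)).
exists (M1 *m M2); split; first exact: admissible_mul.
  by rewrite mulmxA a1.
by rewrite mulmxA b1.
Qed.

(** Two vectors in space leave a third dimension free, so no orientation
    obstructs the move: first a is moved to a' through an intermediate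
    vector, then the image of b is moved while a' stays. *)
Lemma move_pair a b a' b' : indep2 a b -> indep2 a' b' ->
  exists M, [/\ admissible M, a *m M = a' & b *m M = b'].
Proof.
move=> ab ab'; have [g1 g10 [g1a g1b]] := annihilator a a.
have [g2 g20 [g2a g2c]] := annihilator a' a'.
have [p [p1 p2]] := off_planes g10 g20.
have nz u v : indep2 u v -> u != 0.
  move=> uv; apply/eqP => u0; have [|/eqP] := uv 1 0; rewrite ?oner_eq0 //.
  by rewrite u0 scaler0 scale0r addr0.
have off (g : 'cV[R]_3) u v : indep2 u v -> lf g u = 0 -> lf g p <> 0 -> indep2 p u.
  move=> uv gu gpx k m e; have := congr1 (lf g) e.
  rewrite !lfE gu mulr0 addr0 lfv0 => /eqP.
  rewrite mulf_eq0 => /orP[/eqP k0|/eqP //]; split=> //.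
  move: e; rewrite k0 scale0r add0r => /eqP.
  by rewrite scaler_eq0 (negPf (nz _ _ uv)) orbF => /eqP.
have pa := off g1 _ _ ab g1a p1.
have pa' := off g2 _ _ ab' g2a p2.
have [M1 [G1 p1' a1]] := move_second pa pa'.
have ab1 := indep2_mul G1.1 ab; rewrite a1 in ab1.
have [M2 [G2 a2 b2]] := move_second ab1 ab'.
exists (M1 *m M2); split; first exact: admissible_mul.
  by rewrite mulmxA a1.
by rewrite mulmxA.
Qed.

End Alignment.

(** * Transport of generic projections *)

Section Transport.
Context {R : realType}.
Local Notation V := 'rV[R]_3.
Implicit Types (s : seq V) (d p q v w : V) (x y z : nat * R).

Lemma poly_pt_affine (M : 'M[R]_3) w s x : closed_param s x ->
  poly_pt (map (fun p => p *m M + w) s) x = poly_pt s x *m M + w.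
Proof.
move=> [xs _]; have ns : (x.1.+1 %% size s < size s)%N.
  by rewrite ltn_pmod // (leq_ltn_trans _ xs).
rewrite /poly_pt /edge_dir size_map !(nth_map 0) // opprD addrACA subrr addr0.
by rewrite -mulmxBl scalemxAl addrAC -mulmxDl.
Qed.

Lemma edge_dir_affine (M : 'M[R]_3) w s x : closed_param s x ->
  edge_dir (map (fun p => p *m M + w) s) x.1 = edge_dir s x.1 *m M.
Proof.
move=> [xs _]; have ns : (x.1.+1 %% size s < size s)%N.
  by rewrite ltn_pmod // (leq_ltn_trans _ xs).
by rewrite /edge_dir size_map !(nth_map 0) // opprD addrACA subrr addr0 -mulmxBl.
Qed.

Section Affine.
Variables (M : 'M[R]_3) (w d : V).
Hypothesis Mu : M \in unitmx.
Let Phi p : V := p *m M + w.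

Let closed_map s x : closed_param (map Phi s) x -> closed_param s x.
Proof. by rewrite /closed_param size_map. Qed.

Let diff s x y t : closed_param s x -> closed_param s y ->
  poly_pt (map Phi s) x - poly_pt (map Phi s) y = t *: (d *m M) ->
  poly_pt s x - poly_pt s y = t *: d.
Proof.
move=> cx cy; rewrite !poly_pt_affine // opprD addrACA subrr addr0 -mulmxBl scalemxAl.
by move=> /(can_inj (mulmxK Mu)).
Qed.

Lemma regular_along_affine s : regular_along d s ->
  regular_along (d *m M) (map Phi s).
Proof.
move=> reg x y /closed_map cx /closed_map cy xy t /(diff cx cy) e.
have [x0 y0 ind] := reg x y cx cy xy t e; split=> // k m t'.
rewrite !edge_dir_affine // !scalemxAl -mulmxDl => /(can_inj (mulmxK Mu)).
exact: ind.
Qed.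

Lemma no_triple_affine s : no_triple d s -> no_triple (d *m M) (map Phi s).
Proof.
move=> nt x y z /closed_map cx /closed_map cy /closed_map cz t t'.
by move=> /(diff cx cy) + /(diff cy cz); exact: nt.
Qed.

Lemma runs_under_affine A B : runs_under d A B ->
  runs_under (d *m M) (map Phi A) (map Phi B).
Proof.
move=> un x y; rewrite -map_cat => /closed_map cx /closed_map cy xy.
by rewrite size_map => Ay t /(diff cx cy); exact: un.
Qed.

End Affine.

(** Moving vertices along d does not change the projection along d. *)
Section Shear.
Variables (d : V) (s s' : seq V).
Hypothesis sz : size s' = size s.
Hypothesis sh : forall i, exists t, nth 0 s' i - nth 0 s i = t *: d.

Let edge_shear i : exists t, edge_dir s' i = edge_dir s i + t *: d.
Proof.
have [t e] := sh i; have [u e'] := sh (i.+1 %% size s)%N.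
exists (u - t); rewrite /edge_dir sz scalerBl -e -e'.
by apply/rowP => j; rewrite !mxE; ring.
Qed.

Let point_shear x : exists t, poly_pt s' x = poly_pt s x + t *: d.
Proof.
have [t e] := sh x.1; have [u e'] := edge_shear x.1.
exists (t + x.2 * u); rewrite /poly_pt e' scalerDl -e -scalerA.
by apply/rowP => j; rewrite !mxE; ring.
Qed.

Let closed_shear x : closed_param s' x -> closed_param s x.
Proof. by rewrite /closed_param sz. Qed.

Let diff x y t : poly_pt s' x - poly_pt s' y = t *: d ->
  exists t, poly_pt s x - poly_pt s y = t *: d.
Proof.
have [a ->] := point_shear x; have [b ->] := point_shear y => e.
exists (t - a + b); rewrite scalerDl scalerBl -e.
by apply/rowP => j; rewrite !mxE; ring.
Qed.

Lemma regular_along_shear : regular_along d s -> regular_along d s'.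
Proof.
move=> reg x y /closed_shear cx /closed_shear cy xy t /diff[t1 e].
have [x0 y0 ind] := reg x y cx cy xy _ e; split=> // k m t'.
have [a ->] := edge_shear x.1; have [b ->] := edge_shear y.1 => e'.
apply: (ind k m (t' - k * a - m * b)); rewrite !scalerBl -e' -!scalerA.
by apply/rowP => j; rewrite !mxE; ring.
Qed.

Lemma no_triple_shear : no_triple d s -> no_triple d s'.
Proof.
move=> nt x y z /closed_shear cx /closed_shear cy /closed_shear cz t t'.
move=> /diff[t1 e1] /diff[t2 e2]; exact: nt e1 e2.
Qed.

End Shear.

(** When the vertex q recedes to q + t v, the two edges at it rise above
    everything that they cross: a crossing stays where it is in projection, and
    regularity makes it unique for each pair of edges. *)
Lemma high_apex (A : seq V) q v : v != 0 -> (1 < size A)%N ->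
  regular_along v (rcons A q) ->
  exists t0, forall t, t0 <= t -> runs_under (- v) A [:: q + t *: v].
Proof.
move=> v0 A1 reg; set s := rcons A q; set n := size A.
have szs : size s = n.+1 by rewrite size_rcons.
(* Raising the apex by t raises the point y of an edge at the apex by w y * t. *)
pose w y : R := if y.1 == n then 1 - y.2 else y.2.
pose pairs := [seq (i, j) | i <- iota 0 n.-1, j <- [:: n.-1; n]].
(* Large heights are written as inverses of small radii e. *)
pose P (ij : nat * nat) (e : R) := forall t, e^-1 <= t ->
  forall a b k : R, closed_param s (ij.1, a) -> closed_param s (ij.2, b) ->
    poly_pt s (ij.1, a) - poly_pt s (ij.2, b) = k *: v -> k < w (ij.2, b) * t.
have wpos x y k : closed_param s x -> closed_param s y -> x <> y ->
    poly_pt s x - poly_pt s y = k *: v -> 0 < w y.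
  move=> cx cy xy e; have [_ y0 _] := reg x y cx cy xy k e.
  by rewrite /w; case: ifP => // _; case: cy => _ /andP[_]; lra.
have [||e0 e0p he0] := @common_bound R _ pairs P.
- move=> ij d d' d'0 le h t dt; apply: h; apply: le_trans dt.
  by rewrite lef_pV2 // posrE (lt_le_trans d'0).
- move=> _ /allpairsP[[i j] [/= ii jj ->]].
  have ij : i <> j.
    move: ii jj; rewrite mem_iota !inE /= add0n => ii /orP[/eqP->|/eqP->]; lia.
  pose sol (abk : R * R * R) := [/\ closed_param s (i, abk.1.1),
    closed_param s (j, abk.1.2) &
    poly_pt s (i, abk.1.1) - poly_pt s (j, abk.1.2) = abk.2 *: v].
  have [[[[a b] k] [/= ca cb e]]|none] := pselect (exists abk, sol abk); last first.
    by exists 1 => // t _ a b k ca cb e; case: none; exists (a, b, k).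
  have nij (a' b' : R) : (i, a') <> (j, b') :> nat * R by move=> [].
  have wp := wpos _ _ _ ca cb (nij _ _) e.
  exists (`|k| / w (j, b) + 1)^-1.
    by rewrite invr_gt0 ltr_wpDl // divr_ge0 // ltW.
  move=> t; rewrite invrK => tle a' b' k' ca' cb' e'.
  have [_ _ ind] := reg _ _ ca cb (nij _ _) k e.
  have [|ha hb] := ind (a' - a) (- (b' - b)) (k' - k).
    rewrite [RHS]scalerBl -e -e' /poly_pt /=.
    by apply/rowP => l; rewrite !mxE; ring.
  have aa : a' = a by lra.
  have bb : b' = b by lra.
  have kk : k' = k.
    move: e'; rewrite aa bb e => /eqP; rewrite -subr_eq0 -scalerBl scaler_eq0 (negPf v0) orbF.
    by move=> /eqP; lra.
  rewrite bb kk mulrC -ltr_pdivrMr //; apply: lt_le_trans tle.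
  apply: (@le_lt_trans _ _ (`|k| / w (j, b))); last by rewrite ltrDl.
  by rewrite ler_pM2r ?invr_gt0 // ler_norm.
exists e0^-1 => t te x y; rewrite cats1; set s' := rcons A _ => cx cy xy ny u e.
have szs' : size s' = n.+1 by rewrite size_rcons.
have cx' : closed_param s x by rewrite /closed_param szs -szs'.
have cy' : closed_param s y by rewrite /closed_param szs -szs'.
have nthE i : nth 0 s' i = nth 0 s i + (if i == n then t else 0) *: v.
  rewrite !nth_rcons -/n; case: ltngtP => _; rewrite ?scale0r ?addr0 //.
have yn : (y.1 < n.+1)%N by case: cy'; rewrite szs.
have xn : (x.1 < n)%N := leq_trans xy yn.
have n0 : (0 < n)%N := ltnW A1.
have xSn : (x.1.+1 == n) = (x.1 == n.-1) by rewrite -{1}(prednK n0) eqSS.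
have wx : poly_pt s' x = poly_pt s x + (if x.1 == n.-1 then x.2 * t else 0) *: v.
  rewrite /poly_pt /edge_dir szs' szs !nthE (ltn_eqF xn) scale0r addr0.
  rewrite modn_small ?ltnS // xSn.
  case: ifP => _; rewrite ?scale0r ?addr0 // -scalerA.
  by apply/rowP => l; rewrite !mxE; ring.
have wy : poly_pt s' y = poly_pt s y + (w y * t) *: v.
  rewrite /poly_pt /edge_dir szs' szs !nthE /w.
  have [yE|yE] := eqVneq y.1 n.
    rewrite yE modnn (ltn_eqF n0) scale0r addr0 -scalerA.
    by apply/rowP => l; rewrite !mxE; ring.
  have yE' : y.1 = n.-1 by move: yn ny yE; rewrite -/n; lia.
  rewrite modn_small; last by rewrite yE' (prednK n0).
  rewrite yE' (prednK n0) eqxx scale0r addr0 -scalerA.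
  by apply/rowP => l; rewrite !mxE; ring.
have nxy : x <> y by move=> exy; rewrite exy ltnn in xy.
have [xE|xE] := eqVneq x.1 n.-1.
  have yE : y.1 = n by move: xy; rewrite xE; lia.
  have [k ek] : exists k, poly_pt s x - poly_pt s y = k *: v.
    exists (- u - x.2 * t + w y * t); rewrite wx wy xE eqxx in e.
    rewrite scalerDl scalerBl scaleNr -scalerN -e.
    by apply/rowP => l; rewrite !mxE; ring.
  have [_ _ ind] := reg x y cx' cy' nxy k ek.
  have [|x1 _] := ind (- (1 - x.2)) (- y.2) k.
    rewrite -ek /poly_pt /edge_dir szs xE yE (prednK n0) modnn modn_small //.
    by apply/rowP => l; rewrite !mxE; ring.
  by case: cx' => _ /andP[_]; lra.
have ek : poly_pt s x - poly_pt s y = (w y * t - u) *: v.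
  move: e; rewrite wx wy (negPf xE) scale0r addr0 => e.
  rewrite scalerBl -scalerN -e.
  by apply/rowP => l; rewrite !mxE; ring.
have inp : (x.1, y.1) \in pairs.
  apply/allpairsP; exists (x.1, y.1); split=> //=; first by rewrite mem_iota /=; lia.
  rewrite !inE; move: ny yn; rewrite -/n; lia.
have := he0 _ inp t te x.2 y.2 (w y * t - u).
by rewrite /= -!surjective_pairing => /(_ cx' cy' ek); lra.
Qed.

End Transport.

(** * From stick knots to rail arcs *)

Section KnotToRail.
Context {R : realType}.
Local Notation V := 'rV[R]_3.
Implicit Types (s r A : seq V) (d p q u v : V) (x y : nat * R).

Lemma perspK (g : 'cV[R]_3) p : 0 < 1 + lf g p ->
  persp (- g) (persp g p) = p /\ 0 < 1 + lf (- g) (persp g p).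
Proof.
move=> pos; have E : 1 + lf (- g) (persp g p) = (1 + lf g p)^-1.
  by rewrite lfNg perspE lfZ; field; rewrite gt_eqF.
split; last by rewrite E invr_gt0.
rewrite [LHS]perspE E invrK perspE scalerA mulfV ?scale1r //.
by rewrite gt_eqF.
Qed.

(** The bound comes from q / D' - p / D = ((q - p) D - p (D' - D)) / (D' D) for
    the denominators D and D' at p and q, with D' >= D / 2. *)
Lemma persp_continuous (g : 'cV[R]_3) p eps : 0 < eps -> 0 < 1 + lf g p ->
  exists2 e, 0 < e & forall e' q, 0 < e' -> e' <= e -> close e' q p ->
    0 < 1 + lf g q /\ close eps (persp g q) (persp g p).
Proof.
move=> eps0 D0; pose G := \sum_j `|g j 0| + 1; pose N := \sum_j `|p 0 j|.
have G0 : 0 < G by rewrite ltr_wpDl // sumr_ge0.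
have N0 : 0 <= N by rewrite sumr_ge0.
set D := 1 + lf g p in D0; pose K := D + N * G.
have K0 : 0 < K by rewrite ltr_wpDr // mulr_ge0 // ltW.
pose e := Num.min (D / (2 * G)) (eps * D ^+ 2 / (4 * K)).
have e0 : 0 < e.
  by rewrite lt_min !divr_gt0 ?mulr_gt0 ?exprn_gt0.
have eG : e * G <= D / 2.
  have : e <= D / (2 * G) by rewrite ge_min lexx.
  by rewrite ler_pdivlMr ?mulr_gt0 //; lra.
have eK : e * K <= eps * D ^+ 2 / 4.
  have : e <= eps * D ^+ 2 / (4 * K) by rewrite ge_min lexx orbT.
  by rewrite ler_pdivlMr ?mulr_gt0 //; lra.
exists e => // e' q _ le /(close_le le) cl.
have dlf : `|lf g q - lf g p| <= e * G.
  rewrite -lfB lf_sum; apply: (le_trans (ler_norm_sum _ _ _)).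
  apply: (@le_trans _ _ (\sum_j e * `|g j 0|)).
    apply: ler_sum => j _; rewrite normrM ler_wpM2r // ltW // mxE mxE.
    exact: cl.
  by rewrite -mulr_sumr ler_pM2l // /G lerDl.
set D' := 1 + lf g q.
have DD : `|D' - D| <= e * G.
  by rewrite /D' /D opprD addrACA subrr add0r.
have D'0 : D / 2 <= D'.
  by move: DD; rewrite ler_norml => /andP[? _]; lra.
have D'p : 0 < D' by apply: lt_le_trans D'0; rewrite divr_gt0.
split=> // j; rewrite !perspE -/D -/D' !mxE.
have -> : D'^-1 * q 0 j - D^-1 * p 0 j =
    ((q 0 j - p 0 j) * D - p 0 j * (D' - D)) / (D' * D).
  by field; rewrite !gt_eqF.
rewrite normrM normfV (gtr0_norm (mulr_gt0 D'p D0)) ltr_pdivrMr ?mulr_gt0 //.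
apply: (@le_lt_trans _ _ (e * K)).
  apply: (le_trans (ler_normB _ _)); rewrite !normrM (gtr0_norm D0) /K [e * (D + _)]mulrDr.
  apply: lerD; first by rewrite ler_pM2r // ltW // cl.
  rewrite [e * _]mulrCA; apply: ler_pM => //.
  by rewrite /N (bigD1 j) //= lerDl sumr_ge0.
apply: (le_lt_trans eK).
have : eps * D ^+ 2 / 2 <= eps * (D' * D).
  rewrite expr2 -!mulrA ler_pM2l // mulrCA [leRHS]mulrC ler_pM2l //.
have : 0 < eps * D ^+ 2 by rewrite mulr_gt0 // exprn_gt0.
lra.
Qed.

Lemma seq_maximum (s : seq V) (F : V -> R) : s != [::] ->
  exists2 v, v \in s & forall u, u \in s -> F u <= F v.
Proof.
elim: s => // a s IH _; have [->|s0] := eqVneq s [::].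
  by exists a; rewrite ?mem_head // => u; rewrite inE => /eqP->.
have [v vs vmax] := IH s0; have [le|/ltW le] := leP (F a) (F v).
  by exists v; rewrite ?inE ?vs ?orbT // => u; rewrite inE => /orP[/eqP->|/vmax].
exists a; rewrite ?mem_head // => u; rewrite inE => /orP[/eqP->//|/vmax h].
exact: le_trans le.
Qed.

(** A farthest vertex from the origin is exposed: a linear form attains its
    strict maximum over the vertices there. *)
Lemma exposed_vertex s : stick_knot s -> exists v r n (g : 'cV[R]_3),
  [/\ rot n s = v :: r, lf g v = 1, v != 0 & forall u, u \in r -> lf g u < 1].
Proof.
move=> st; have sz3 := stick_knot_size st.
have [|v vs vmax] := @seq_maximum s (fun u => dotv u u); first by case: (s) sz3.
have [n r rE] := rot_to vs.
have un : uniq (v :: r) by rewrite -rE rot_uniq; exact: stick_knot_uniq.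
have far u : u \in r -> dotv u v < dotv v v.
  move=> ur; have uv : u - v != 0.
    rewrite subr_eq0; apply: contraTneq ur => ->; by case/andP: un.
  have us : u \in s by rewrite -(mem_rot n) rE inE ur orbT.
  have := dotv_gt0 uv; have := vmax u us.
  have sym : dotv v u = dotv u v.
    by rewrite !dotvE !lf_sum; apply: eq_bigr => j _; rewrite !mxE mulrC.
  have -> : dotv (u - v) (u - v) = dotv u u - 2 * dotv u v + dotv v v.
    have addr a b c : dotv a (b - c) = dotv a b - dotv a c.
      by rewrite /dotv linearB /= mulmxBr !mxE.
    rewrite addr !dotvE !lfB -!dotvE sym; ring.
  lra.
have v0 : v != 0.
  have [u ur] : exists u, u \in r.
    have : size r = (size s).-1 by rewrite -(size_rot n s) rE.
    by case: (r) => [/= h|u r' _]; [exfalso; lia|exists u; rewrite mem_head].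
  apply: contraTneq (far u ur) => ->.
  by rewrite !dotvE !lf_sum !big1 ?ltxx // => j _; rewrite !mxE ?mul0r ?mulr0.
have vv := dotv_gt0 v0.
exists v, r, n, ((dotv v v)^-1 *: v^T).
have gE p : lf ((dotv v v)^-1 *: v^T) p = dotv p v / dotv v v.
  by rewrite /lf -scalemxAr mxE mulrC.
split=> //; first by rewrite gE divff // gt_eqF.
by move=> u ur; rewrite gE ltr_pdivrMr // mul1r; exact: far.
Qed.

(** Sending an exposed vertex v to infinity by a perspectivity turns its two
    sticks into parallel rays and the other sticks into an arc A.  After a
    perturbation that makes the projection of A along v generic, A is closed by
    an arc through a point q high above it; by the cone lemma, applied in the
    direction -v, this closed polygon is equivalent to the perturbed knot. *)
Lemma knot_over_form s : stick_knot s -> exists A q v,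
  [/\ size A = (size s).-1, v != 0, knot_equiv s (rcons A q),
      stick_knot (rcons A q) & [/\ regular_along v (rcons A q), no_triple v (rcons A q) &
      runs_under (- v) A [:: q]]].
Proof.
move=> st; have sz3 := stick_knot_size st.
have [v [r [n [g [rE gv v0 gr]]]]] := exposed_vertex st.
have stv : stick_knot (v :: r) by rewrite -rE; exact: stick_knot_rot.
have szr : size r = (size s).-1 by rewrite -(size_rot n s) rE.
have [eps eps0 heps] := knot_stable stv.
(* persp (- g) sends v to infinity, and persp g is its inverse. *)
pose A0 := map (persp (- g)) r.
have rpos p : p \in r -> 0 < 1 + lf (- g) p by move=> /gr; rewrite lfNg; lra.
have A0pos p : p \in A0 -> 0 < 1 + lf g p.
  by move=> /mapP[u /rpos upos ->]; have [_] := perspK upos; rewrite opprK.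
have A0r : map (persp g) A0 = r.
  rewrite -map_comp -[RHS]map_id; apply/eq_in_map => u /rpos upos /=.
  by have [+ _] := perspK upos; rewrite opprK.
have [||e0 e0p he] := @common_bound R _ A0 (fun p e => forall e' q,
   0 < e' -> e' <= e -> close e' q p -> 0 < 1 + lf g q /\ close eps (persp g q) (persp g p)).
- move=> p d d' _ le h e' q e'0 e'd; apply: h => //; exact: le_trans le.
- by move=> p /A0pos; exact: persp_continuous.
have szA0 : size A0 = (size s).-1 by rewrite size_map.
(* The vertex 0 is a placeholder for the vertex that will be raised. *)
have [|s' [[szs' cs'] reg nt]] := @perturb_regular R v (rcons A0 0) e0 v0 _ e0p.
  by rewrite size_rcons szA0; lia.
case/lastP: s' szs' cs' reg nt => [|A q]; first by rewrite size_rcons.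
rewrite !size_rcons => -[szA] cs reg nt.
have cA i : (i < size A)%N -> close e0 (nth 0 A i) (nth 0 A0 i).
  by move=> iA; have := cs i; rewrite !nth_rcons szA -szA iA.
have he' i : (i < size A)%N -> 0 < 1 + lf g (nth 0 A i) /\
    close eps (persp g (nth 0 A i)) (persp g (nth 0 A0 i)).
  by move=> iA; apply: (he _ _ e0) (cA i iA) => //; rewrite mem_nth // -szA.
have Apos p : p \in A -> 0 < 1 + lf g p.
  by move=> /(nthP 0)[i iA <-]; have [] := he' i iA.
have [|stA eqA] := heps (v :: map (persp g) A).
  split; first by rewrite /= !size_map szA size_map.
  case=> [|i] /=; first by move=> j; rewrite subrr normr0.
  have [iA|iA] := ltnP i (size A).
    rewrite (nth_map 0) // -A0r (nth_map 0) -?szA //; exact: (he' i iA).2.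
  by move=> j; rewrite !nth_default ?size_map ?subrr ?normr0 // -?(size_map (persp (- g)) r) -?/A0 -?szA.
have A1 : (1 < size A)%N by rewrite szA szA0; lia.
have [t0 ht0] := high_apex v0 A1 reg.
pose t := Num.max t0 (`|lf g q| + 1).
have tt0 : t0 <= t by rewrite le_max lexx.
have tq : `|lf g q| + 1 <= t by rewrite le_max lexx orbT.
have un := ht0 t tt0; set q' := q + t *: v in un.
have szq : size (rcons A q') = size (rcons A q) by rewrite !size_rcons.
have sh i : exists k, nth 0 (rcons A q') i - nth 0 (rcons A q) i = k *: v.
  rewrite !nth_rcons; case: ltngtP => _.
  - by exists 0; rewrite subrr scale0r.
  - by exists 0; rewrite subrr scale0r.
  - by exists t; rewrite /q' addrC addKr.
have reg' := regular_along_shear szq sh reg.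
have nt' := no_triple_shear szq sh nt.
have vN0 : - v != 0 by rewrite oppr_eq0.
have regN := regular_alongN reg'; rewrite -cats1 in regN.
have stq : stick_knot (A ++ [:: q']).
  apply: (closes_knot vN0) => //; first by rewrite size_cat addn1.
  move=> [i a] [j b] ci cj /= iA jA e.
  case: ci => _ /= /andP[a0 a1]; case: cj => _ /= /andP[b0 b1].
  have Cp k : (k < size A)%N -> 0 < 1 + 1 * (lf (- g) (persp g (nth 0 A k)) + 0).
    move=> kA; rewrite mul1r addr0; apply: (perspK _).2; apply: Apos; exact: mem_nth.
  have back k : (k < size A)%N -> nth 0 A k = persp (- g) (persp g (nth 0 A k)).
    by move=> kA; rewrite (perspK _).1 //; apply: Apos; exact: mem_nth.
  have pre k c : (k.+1 < size A)%N -> 0 <= c -> c < 1 ->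
      half_edge (persp (- g) (persp g (nth 0 A k)), persp (- g) (persp g (nth 0 A k.+1)))
        (poly_pt A (k, c)).
    move=> kA c0 c1; rewrite -!back ?(ltnW kA) //; exists c; split=> //.
    by rewrite /poly_pt /edge_dir modn_small.
  have [p [Cp1 pe pE]] := persp_edges (Cp _ (ltnW iA)) (Cp _ iA) (pre i a iA a0 a1).
  have [p' [Cp1' pe' pE']] := persp_edges (Cp _ (ltnW jA)) (Cp _ jA) (pre j b jA b0 b1).
  have pp : p = p' by apply: (persp_inj Cp1 Cp1'); rewrite -pE -pE'.
  have szv : size (v :: map (persp g) A) = (size A).+1 by rewrite /= size_map.
  have ed k : (k.+1 < size A)%N -> nth (0, 0) (edges (v :: map (persp g) A)) k.+1 =
      (persp g (nth 0 A k), persp g (nth 0 A k.+1)).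
    move=> kA; rewrite nth_edges szv; last by rewrite ltnS ltnW.
    by rewrite modn_small //= !(nth_map 0) // ltnW.
  have ij : i = j.
    apply: contrapT => ij; have /stick_knotE[_ sim] := stA.
    have lt k : (k.+1 < size A)%N -> (k.+1 < size (edges (v :: map (persp g) A)))%N.
      by move=> kA; rewrite size_edges /= size_map ltnS ltnW.
    have ij' : i.+1 <> j.+1 by move=> [].
    have := simple_disj sim (lt _ iA) (lt _ jA) ij'.
    rewrite !ed // => /(_ p pe); apply; by rewrite pp.
  congr pair => //; move: e; rewrite -ij /poly_pt /= /edge_dir modn_small //.
  apply: (edge_inj (e := (nth 0 A i, nth 0 A i.+1))) => /=.
  apply/eqP => eA; have : nth 0 (v :: map (persp g) A) i.+1 = nth 0 (v :: map (persp g) A) i.+2.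
    by rewrite /= !(nth_map 0) ?eA // ltnW.
  have := stick_knot_uniq stA => /(uniqP 0) inj /inj.
  rewrite !inE /= size_map !ltnS => /(_ (ltnW iA) iA).
  by move=> /n_Sn.
have gvN : lf g (- v) < 0 by rewrite lfN gv ltrN10.
have [|_ eqc] := cone_closure gvN A1 stq regN un.
  move=> p; rewrite mem_cat mem_seq1 => /orP[/Apos //|/eqP->].
  by rewrite /q' !lfE gv mulr1; have := ler_norm (- lf g q); rewrite normrN; lra.
exists A, q'; exists v; rewrite -cats1; split=> //.
- by rewrite szA.
- apply: (KnotTrans (KnotRot n s)); rewrite rE; apply: (KnotTrans eqA); apply: KnotSym.
  move: eqc; rewrite lfN gv invrN1 scaleN1r opprK //.
by rewrite cats1.
Qed.

End KnotToRail.

(** * Placement on given rails *)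

Section Final.
Context {R : realType} (L : rails R).
Local Notation V := 'rV[R]_3.
Implicit Types (s A B : seq V) (d p q u v : V) (x y : nat * R).
Local Notation d := (rail_dir L).

(** The end of an edge is the start of the next one; the vertex q supplies an
    edge that starts at the end of the arc. *)
Lemma arc_param_closed A q x : (1 < size A)%N -> arc_param A x -> exists x',
  [/\ closed_param (rcons A q) x', (x'.1 < size A)%N,
      poly_pt (rcons A q) x' = poly_pt A x & arc_time x' = arc_time x].
Proof.
move=> A1; case: x => i t [/= iA /andP[t0 t1]].
have E : poly_pt (rcons A q) (i, t) = poly_pt A (i, t) by rewrite -cats1 poly_pt_cat.
have [t1'|t1'] := eqVneq t 1.
  exists (i.+1, 0); split=> //=.
  - by split=> /=; [rewrite size_rcons ltnS ltnW|rewrite lexx ltr01].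
  - rewrite -E /poly_pt /edge_dir size_rcons scale0r addr0 /= modn_small ?ltnS ?(ltnW iA) //.
    by rewrite t1' scale1r addrC subrK.
  - by rewrite /arc_time /= addr0 t1' natr1.
exists (i, t); split=> //=; last exact: ltnW.
split=> /=; first by rewrite size_rcons ltnS ltnW // ltnW.
by rewrite t0 lt_neqAle t1'.
Qed.

(** The rails are the vertical lines through the two ends of the arc, and
    regularity forbids other points on the vertical line of a vertex. *)
Lemma rail_arc_of_knot A q : (1 < size A)%N -> stick_knot (rcons A q) ->
  regular_along d (rcons A q) ->
  head 0 A = rail_base1 L -> last 0 A = rail_base2 L -> stick_rail_arc L A.
Proof.
move=> A1 [_ inj] reg hA lA.
have A0 : (0 < size A)%N := ltnW A1.
have rail0 k b t x : (k < size A)%N -> nth 0 A k = b -> arc_param A x ->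
    poly_pt A x = b + t *: d -> arc_time x = k%:R.
  move=> kA kb cx px.
  have [x' [cx' _ px' <-]] := arc_param_closed q A1 cx.
  have ck : closed_param (rcons A q) (k, 0).
    by split=> /=; [rewrite size_rcons ltnS ltnW|rewrite lexx ltr01].
  have [->|ne] := pselect (x' = (k, 0)); first by rewrite /arc_time addr0.
  have [|_] := reg x' (k, 0) cx' ck ne t; last by rewrite ltxx.
  rewrite px' px [poly_pt _ (k, 0)]/poly_pt /= scale0r addr0 nth_rcons kA kb.
  by rewrite addrC addKr.
split=> //.
- move=> x y cx cy e.
  have [x' [cx' _ ex <-]] := arc_param_closed q A1 cx.
  have [y' [cy' _ ey <-]] := arc_param_closed q A1 cy.
  by congr arc_time; apply: inj => //; rewrite ex ey.
- by rewrite hA; exists 0; rewrite scale0r addr0.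
- by rewrite lA; exists 0; rewrite scale0r addr0.
move=> x cx /andP[tx0 tx1] [[t]|[t]].
  by move=> /(rail0 0%N _ _ _ A0 _ cx) xt; move: tx0; rewrite xt ?ltxx // nth0.
have nA : ((size A).-1 < size A)%N by rewrite prednK.
by move=> /(rail0 _ _ _ _ nA _ cx) xt; move: tx1; rewrite xt ?ltxx // nth_last.
Qed.

(** The arc obtained above is moved onto the given rails: the direction v and
    the vector joining its ends go to the direction and the displacement of the
    rails. *)
Lemma stick_knot_companion s (K : seq V) : stick_knot s -> knot_equiv s K ->
  exists A, [/\ stick_rail_arc L A, over_companion L A K & size A = (size s).-1].
Proof.
move=> st eK; have sz3 := stick_knot_size st.
have [A [q [v [szA v0 eq stq [reg nt un]]]]] := knot_over_form st.
have A1 : (1 < size A)%N by rewrite szA; lia.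
have A0 : (0 < size A)%N := ltnW A1.
set h := nth 0 A 0; set e := nth 0 A (size A).-1.
have nA : ((size A).-1 < size A)%N by rewrite prednK.
have vert k : (k < size A)%N -> closed_param (rcons A q) (k, 0) /\
    poly_pt (rcons A q) (k, 0) = nth 0 A k.
  move=> kA; split.
    by split=> /=; [rewrite size_rcons ltnS ltnW|rewrite lexx ltr01].
  by rewrite /poly_pt /= scale0r addr0 nth_rcons kA.
have ind : indep2 v (e - h).
  move=> k m km; have [m0|m0] := eqVneq m 0.
    split=> //; move: km; rewrite m0 scale0r addr0 => /eqP.
    by rewrite scaler_eq0 (negPf v0) orbF => /eqP.
  have [ch ph] := vert _ A0; have [ce pe] := vert _ nA.
  have [||] := reg _ _ ce ch _ (- (k / m)); last by rewrite ltxx.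
    by move=> [e0]; move: A1; rewrite -(prednK A0) e0.
  rewrite pe ph -/h -/e.
  have -> : e - h = m^-1 *: (k *: v + m *: (e - h) - k *: v).
    by rewrite [k *: _ + _]addrC addrK scalerA mulVf // scale1r.
  by rewrite km sub0r scalerN scalerA scaleNr mulrC.
have indL : indep2 d (rail_base2 L - rail_base1 L).
  move=> k m km; have [m0|m0] := eqVneq m 0.
    split=> //; move: km; rewrite m0 scale0r addr0 => /eqP.
    by rewrite scaler_eq0 (negPf (rail_dir_neq0 L)) orbF => /eqP.
  case/negP: (rails_distinct L (- (k / m))); apply/eqP.
  have -> : rail_base2 L - rail_base1 L =
      m^-1 *: (k *: d + m *: (rail_base2 L - rail_base1 L) - k *: d).
    by rewrite [k *: _ + _]addrC addrK scalerA mulVf // scale1r.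
  by rewrite km sub0r scalerN scalerA scaleNr mulrC.
have [M [[Mu pM] vM eM]] := move_pair ind indL.
pose w := rail_base1 L - h *m M; pose Phi p := p *m M + w.
have [stP eqP] := preserves_knots_comp pM (preserves_knots_shift w) stq.
rewrite -[map _ _]/(map Phi (rcons A q)) map_rcons in stP eqP.
have regP := regular_along_affine (w := w) Mu reg.
have ntP := no_triple_affine (w := w) Mu nt.
have unP := runs_under_affine (w := w) Mu un.
rewrite vM map_rcons -/Phi in regP ntP; rewrite mulNmx vM -/Phi in unP.
exists (map Phi A); split; last by rewrite size_map.
- apply: rail_arc_of_knot stP regP _ _; first by rewrite size_map.
    by rewrite -nth0 (nth_map 0) // /Phi -/h /w addrC subrK.
  rewrite -nth_last size_map (nth_map 0) // -/e /Phi /w.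
  by rewrite addrCA -mulmxBl eM addrC subrK.
exists [:: Phi q].
  apply/closes_over; split=> //; rewrite cats1.
  apply/regular_projectionE; first exact: rail_dir_neq0.
  by split; rewrite ?size_rcons.
rewrite cats1; apply: KnotTrans eK; apply: KnotSym; exact: KnotTrans eqP.
Qed.

End Final.

(** * Minima *)

Lemma nat_min_eq (A : set nat) m : A m -> (forall k, A k -> (m <= k)%N) -> nat_min A = m.
Proof.
move=> Am min; rewrite /nat_min; apply: xget_unique; first by split.
by move=> k [Ak kmin]; apply/eqP; rewrite eqn_leq min // kmin.
Qed.

Lemma nat_min0 (A : set nat) : (forall k, ~ A k) -> nat_min A = 0%N.
Proof. by move=> h; apply: xgetPN => k [/h]. Qed.

Lemma has_least (A : set nat) k : A k -> exists2 m, A m & forall k, A k -> (m <= k)%N.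
Proof.
move=> Ak; have ex : exists n, `[< A n >] by exists k; apply/asboolP.
have [m /asboolP Am min] := ex_minnP ex.
by exists m => // l Al; apply: min; apply/asboolP.
Qed.

Theorem theorem4p3 (R : realType) (L : rails R) (k : rolfsen_name) :
  rail_stick_number L (rolfsen_knot R k)
  = (stick_number (rolfsen_knot R k) - 2)%N.
Proof.
set K := rolfsen_knot R k.
rewrite /rail_stick_number /stick_number; set RS := [set n | _]; set S := [set n | _].
have toS n : RS n -> S n.+2.
  move=> [A [arc comp szA]]; have [s [st eK szs]] := companion_stick_knot arc comp.
  by exists s; rewrite szs szA.
have toRS n : S n -> (2 < n)%N /\ RS (n - 2)%N.
  move=> [s [st eK <-]]; have sz3 := stick_knot_size st; split=> //.
  have [A [arc comp szA]] := stick_knot_companion L st eK.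
  by exists A; split=> //; [right|rewrite szA; lia].
have [[n Sn]|noS] := pselect (exists n, S n); last first.
  rewrite !nat_min0 // => n; [by move=> Sn; apply: noS; exists n|].
  by move=> /toS Sn; apply: noS; exists n.+2.
have [m Sm min] := has_least Sn; have [m3 RSm] := toRS m Sm.
rewrite (nat_min_eq Sm min); apply: nat_min_eq => // l /toS /min; lia.
Qed.
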